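(* Fix $p\in[1,\infty]$. Let $x:L\to L_p(\mathcal A)$ be an operator of type $(\star)$ (see context). Let $m,M:L_p(\mathcal B)^+\to L_p(\mathcal A)^+$ be weak $\mathcal A$-homogeneous operators such that $m$ is superlinear, $M$ is sublinear and, if $p=\infty$, $M$ is also regular. Assume the sandwich condition $$m(Z)+x(X)\le M(Y)\qquad \forall X\in L,\ \forall\,Y,Z\in L_p(\mathcal B)^+\text{ with } Z+X\le Y.$$ Then $x$ admits an extension $\hat x$ to the whole $L_p(\mathcal B)$ (with values in $L_p(\mathcal A)$) which is convex, monotone, lower semicontinuous, weak $\mathcal A$-homogeneous, satisfies the projection property, and preserves the sandwich condition: $$m(Z)+\hat x(X)\le M(Y)\qquad \forall X\in L_p(\mathcal B),\ \forall\,Y,Z\in L_p(\mathcal B)^+\text{ with } Z+X\le Y.$$ In particular, the operator $$\hat x(X):=\operatorname*{ess\,sup}_{V\in\mathcal V^S}\{V(X)-x^*(V)\},\quad X\in L_p(\mathcal B),\qquad x^*(V):=\operatorname*{ess\,sup}_{X\in L}\{V(X)-x(X)\},$$ is such a sandwich preserving extension of $x$, where $\mathcal V^S$ is the set of linear, continuous, non-negative, $\mathcal A$-homogeneous operators $V:L_p(\mathcal B)\to L_p(\mathcal A)$ such that $E[x^*(V)]<\infty$ and $m(X)\le V(X)\le M(X)$ for all $X\in L_p(\mathcal B)^+$. Moreover, for any other such extension $\bar x$ of $x$ one has $$\hat x(X)\ge\bar x(X),\qquad X\in L_p(\mathcal B).$$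
   Context: $(\Omega,\mathcal B,P)$ is a complete probability space, where $\mathcal B$ is the $P$-completion of a $\sigma$-algebra generated by a countable family of sets, and $\mathcal A\subseteq\mathcal B$ is a $P$-augmented countably generated $\sigma$-algebra. $L_p(\mathcal B)$ and $L_p(\mathcal A)$ carry the norm topology if $p<\infty$ and the weak* topology $\sigma(L_\infty,L_1)$ if $p=\infty$; the superscript $+$ denotes the cone of non-negative elements. $L\subseteq L_p(\mathcal B)$ is a linear subspace with the induced topology such that: (i) $1\in L$; (ii) $1_AX\in L$ for all $A\in\mathcal A$, $X\in L$; (iii) if $(X_n)\subset L$, $\sup_n\|X_n\|_p<\infty$ and $X_n\to X$ $P$-a.s., then $X\in L$. An operator $x:L\to L_p(\mathcal A)$ is of type $(\star)$ if it is: monotone ($x(X')\ge x(X'')$ whenever $X'\ge X''$ in $L$); convex ($x(\lambda X'+(1-\lambda)X'')\le\lambda x(X')+(1-\lambda)x(X'')$ for $\lambda\in[0,1]$); has the Fatou property (if $(X_n)\subset L$, $\sup_n\|X_n\|_p<\infty$ and $X_n\to X$ $P$-a.s., then $\liminf_n x(X_n)\ge x(X)$); weak $\mathcal A$-homogeneous ($x(1_AX)=1_Ax(X)$ for $A\in\mathcal A$); and has the projection property ($x(f)=f$ for $f\in L_p(\mathcal A)\cap L$). For operators on $L_p(\mathcal B)$ or $L_p(\mathcal B)^+$ these notions are understood analogously. $V$ is $\mathcal A$-homogeneous if $V(\xi X)=\xi V(X)$ for all $X\in L_p(\mathcal B)$, $\xi\in L_p(\mathcal A)$ with $\xi X\in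 L_p(\mathcal B)$. $m$ superlinear: $m(X+Y)\ge m(X)+m(Y)$ and $m(\lambda X)=\lambda m(X)$ for $X,Y\in L_p(\mathcal B)^+$, $\lambda\ge0$. $M$ sublinear: $M(X+Y)\le M(X)+M(Y)$ and $M(\lambda X)=\lambda M(X)$ for $X,Y\in L_p(\mathcal B)^+$, $\lambda\ge0$. For $p=\infty$, $M$ is regular if $M(X_n)\to0$ $P$-a.s. for every decreasing sequence $(X_n)$ in $L_\infty(\mathcal B)$ with $X_n\downarrow0$ $P$-a.s. An operator $y:L_p(\mathcal B)\to L_p(\mathcal A)$ is lower semicontinuous if for every $\eta\in L_p(\mathcal A)$ the set $\{X\in L_p(\mathcal B): y(X)\le\eta\}$ is closed in $L_p(\mathcal B)$. *)

(* Defs.v *)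
From HB Require Import structures.
From mathcomp Require Import all_boot all_order all_algebra.
From mathcomp Require Import all_classical all_reals all_analysis.
From mathcomp Require Import measurable_realfun.

Set Implicit Arguments.
Unset Strict Implicit.
Unset Printing Implicit Defensive.
Import Order.TTheory GRing.Theory Num.Theory.
Import numFieldNormedType.Exports.

Local Open Scope classical_set_scope.
Local Open Scope ring_scope.

(* Elements of L_p are represented by functions T -> R, identified up to
   P-a.e. equality. Hence every equality and inequality between random
   variables is stated a.e., a set of elements of L_p is a set of functions
   closed under a.e. equality, and an operator is a map on functions that
   respects a.e. equality on its domain (its values outside of the domain are
   irrelevant). Sigma-algebras on T are sets of sets; [d.-measurable] is the
   largest one, the domain of P. *)

Section Setting.
Context {d : measure_display} {T : measurableType d} {R : realType}.
Variable P : probability T R.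
Implicit Types (F A : set (set T)) (p : \bar R) (X Y Z : T -> R).

Definition ae_le X Y := \forall t \ae P, X t <= Y t.

Definition ae_cvg (X_ : nat -> T -> R) X :=
  \forall t \ae P, X_ n t @[n --> \oo] --> X t.

Definition completion_of_countably_generated F :=
  exists2 G : set (set T), countable G
    & F = @completed_algebra_gen _ (g_sigma_algebraType G) R P.

Definition augmented_countably_generated F :=
  exists G : set (set T), [/\ countable G, G `<=` d.-measurable
    & F = <<s G `|` P.-negligible >>].

(* L_p(F), for F a sub-sigma-algebra of [d.-measurable]; when F contains the
   P-null sets, F-measurability is invariant under a.e. equality. *)
Definition Lp F p : set (T -> R) :=
  [set X | X \in Lfun P p
    /\ measurable_fun [set: g_sigma_algebraType F] (X : g_sigma_algebraType F -> R)].

Definition Lp_nneg F p : set (T -> R) := Lp F p `&` [set X | ae_le (cst 0) X].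

(* Neighbourhoods in L_p(F): norm topology for p < +oo, weak-star topology
   sigma(L_oo(F), L_1(F)) for p = +oo. *)
Definition Lp_nbhs F p X : set_system (T -> R) :=
  if p == +oo%E then
    [set U | exists k (g : 'I_k -> T -> R) (e : R),
      [/\ 0 < e, forall i, Lp F 1%E (g i)
        & forall Y, Lp F p Y ->
          (forall i, (`| 'E_P[(g i \* (Y \- X))%R] | < e%:E)%E) -> U Y]]
  else
    [set U | exists2 e : R, 0 < e
      & forall Y, Lp F p Y -> ('N[P]_p[EFin \o (Y \- X)%R] < e%:E)%E -> U Y].

Definition Lp_closed F p (C : set (T -> R)) :=
  forall X, Lp F p X ->
    (forall U, Lp_nbhs F p X U -> exists2 Y, Lp F p Y & (C `&` U) Y) -> C X.

Definition Lp_bounded p (X_ : nat -> T -> R) :=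
  (ereal_sup (range (fun n => 'N[P]_p[EFin \o X_ n])) < +oo)%E.

(* [f] is an essential supremum of the family [S] of random variables: the
   least extended real-valued random variable dominating a.s. each member. *)
Definition is_esssup (S : set (T -> \bar R)) (f : T -> \bar R) :=
  [/\ measurable_fun [set: T] f,
      forall h, S h -> \forall t \ae P, (h t <= f t)%E
    & forall g, measurable_fun [set: T] g ->
        (forall h, S h -> \forall t \ae P, (h t <= g t)%E) ->
        \forall t \ae P, (f t <= g t)%E].

(* a version of the essential supremum, which is unique up to a.e. equality *)
Definition esssup (S : set (T -> \bar R)) : T -> \bar R :=
  xget (cst -oo%E) (is_esssup S).

End Setting.

Section Operators.
Context {d : measure_display} {T : measurableType d} {R : realType}.
Variables (P : probability T R) (A : set (set T)) (p : \bar R).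
Implicit Types (X Y Z f xi eta : T -> R) (D E : set (T -> R)).
Implicit Types (x y m M V : (T -> R) -> T -> R).

Local Notation LB := (Lp P d.-measurable p).
Local Notation LA := (Lp P A p).
Local Notation LBp := (Lp_nneg P d.-measurable p).
Local Notation LAp := (Lp_nneg P A p).

Definition is_operator D E y :=
  (forall X, D X -> E (y X)) /\
  (forall X Y, D X -> D Y -> X = Y %[ae P] -> y X = y Y %[ae P]).

Definition monotone_on D y :=
  forall X Y, D X -> D Y -> ae_le P X Y -> ae_le P (y X) (y Y).

Definition convex_on D y :=
  forall X Y (l : R), D X -> D Y -> 0 <= l <= 1 ->
    ae_le P (y (l \*: X \+ (1 - l) \*: Y)) (l \*: y X \+ (1 - l) \*: y Y).

Definition Fatou_on D y :=
  forall (X_ : nat -> T -> R) X, (forall n, D (X_ n)) -> Lp_bounded P p X_ ->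
    ae_cvg P X_ X ->
    \forall t \ae P, ((y X t)%:E <= limn_einf (fun n => (y (X_ n) t)%:E))%E.

Definition weak_homogeneous_on D y :=
  forall (H : set T) X, A H -> D X ->
    y (\1_H \* X) = \1_H \* y X %[ae P].

Definition projection_on D y :=
  forall f, LA f -> D f -> y f = f %[ae P].

Definition type_star D x :=
  is_operator D LA x /\
  [/\ monotone_on D x, convex_on D x, Fatou_on D x,
      weak_homogeneous_on D x & projection_on D x].

Record good_subspace (L : set (T -> R)) : Prop := GoodSubspace {
  gs_sub : L `<=` LB;
  gs_ae : forall X Y, L X -> X = Y %[ae P] -> L Y;
  gs_add : forall X Y, L X -> L Y -> L (X \+ Y);
  gs_scale : forall (a : R) X, L X -> L (a \*: X);
  gs_one : L (cst 1);
  gs_indic : forall (H : set T) X, A H -> L X -> L (\1_H \* X);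
  gs_lim : forall (X_ : nat -> T -> R) X, (forall n, L (X_ n)) ->
    Lp_bounded P p X_ -> ae_cvg P X_ X -> L X
}.

Definition nneg_homogeneous y :=
  forall X (l : R), LBp X -> 0 <= l -> y (l \*: X) = l \*: y X %[ae P].

Definition superlinear m :=
  (forall X Y, LBp X -> LBp Y -> ae_le P (m X \+ m Y) (m (X \+ Y))) /\
  nneg_homogeneous m.

Definition sublinear M :=
  (forall X Y, LBp X -> LBp Y -> ae_le P (M (X \+ Y)) (M X \+ M Y)) /\
  nneg_homogeneous M.

(* Used only for p = +oo; the X_ n are a.s. non-negative, being decreasing
   with limit 0, so that they lie in the domain of M. *)
Definition regular M :=
  forall X_ : nat -> T -> R, (forall n, LB (X_ n)) ->
    (forall n, ae_le P (X_ n.+1) (X_ n)) -> ae_cvg P X_ (cst 0) ->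
    ae_cvg P (fun n => M (X_ n)) (cst 0).

Definition sandwich m M D x :=
  forall X Y Z, D X -> LBp Y -> LBp Z ->
    ae_le P (Z \+ X) Y -> ae_le P (m Z \+ x X) (M Y).

Definition lower_semicontinuous y :=
  forall eta, LA eta ->
    Lp_closed P d.-measurable p [set X | LB X /\ ae_le P (y X) eta].

Record sandwich_extension (L : set (T -> R)) x m M y : Prop :=
  SandwichExtension {
    se_operator : is_operator LB LA y;
    se_extends : forall X, L X -> y X = x X %[ae P];
    se_convex : convex_on LB y;
    se_monotone : monotone_on LB y;
    se_lsc : lower_semicontinuous y;
    se_homogeneous : weak_homogeneous_on LB y;
    se_projection : projection_on LB y;
    se_sandwich : sandwich m M LB y
  }.

Definition linear_operator V :=
  forall (a : R) X Y, LB X -> LB Y ->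
    V (a \*: X \+ Y) = a \*: V X \+ V Y %[ae P].

Definition continuous_operator V :=
  forall X, LB X -> forall U, Lp_nbhs P A p (V X) U ->
    Lp_nbhs P d.-measurable p X (V @^-1` U).

Definition nonnegative_operator V :=
  forall X, LBp X -> ae_le P (cst 0) (V X).

Definition homogeneous V :=
  forall X xi, LB X -> LA xi -> LB (xi \* X) ->
    V (xi \* X) = xi \* V X %[ae P].

Definition xstar (L : set (T -> R)) x V : T -> \bar R :=
  esssup P [set (fun t => (V X t - x X t)%:E) | X in L].

Definition VS (L : set (T -> R)) x m M : set ((T -> R) -> T -> R) :=
  [set V | is_operator LB LA V /\
    [/\ linear_operator V, continuous_operator V, nonnegative_operator V
      & homogeneous V] /\
    (\int[P]_t xstar L x V t < +oo)%E /\
    (forall X, LBp X -> ae_le P (m X) (V X) /\ ae_le P (V X) (M X))].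

Definition xhat (L : set (T -> R)) x m M X : T -> \bar R :=
  esssup P [set (fun t => (V X t)%:E - xstar L x V t)%E | V in VS L x m M].

End Operators.

(* Main.v *)
Require Import Defs.
From HB Require Import structures.
From mathcomp Require Import all_boot all_order all_algebra.
From mathcomp Require Import all_classical all_reals all_analysis.
From mathcomp Require Import measurable_realfun.
From mathcomp Require Import ring lra.

Set Implicit Arguments.
Unset Strict Implicit.
Unset Printing Implicit Defensive.
Import Order.TTheory GRing.Theory Num.Theory.
Import numFieldNormedType.Exports.

Local Open Scope classical_set_scope.
Local Open Scope ring_scope.

(* Fix X0 in L. The scalar functional E x is convex on L and is sandwiched
   between the superlinear E m and the sublinear E M, so that the infimal
   convolution of E x(X0 + .) - E x(X0) with E M and E m is a finite convex
   functional; by Hahn-Banach there is a linear v below it. Then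
   E m <= v <= E M on the positive cone, and v - E x is maximal on L at X0. Since
   v(1_H X) <= E[1_H M X] for H in A, Radon-Nikodym turns v into an A-homogeneous
   operator V with v = E V and m <= V <= M. It is norm continuous because it is
   positive (p < oo), and weak-star continuous by regularity of M (p = oo).
   Pasting along sets of A gives E x^*(V) = sup_L (v - E x) = v(X0) - E x(X0),
   which forces V X0 - x^*(V) = x X0 almost surely.

   Hence the supremum xhat of the V - x^*(V) agrees with x on L, and the other
   properties pass from the V's to their supremum. Neither the Fatou property
   nor lower semicontinuity was used to build V, so any other extension z is
   supported in the same way at each point of L_p(B); as x^* <= z^*, the
   supporting operators belong to V^S, whence z <= xhat. *)

(** * Convex functionals and sandwiched linear functionals *)

(** The sandwich condition bounds [x X] at [X] itself, whereas support at [X0] needs a bound on the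
    increment [x X0 - x X]. A recession argument supplies it: large multiples of [X0 - X] obey the
    sandwich, and convexity carries their slope back to the increment. This is what makes the
    infimal convolution nonnegative at 0, hence finite.

    Hahn-Banach is applied algebraically in the space of all functions [T -> R], with L_p as a mere
    subset: no topology and no quotient by null functions. Invariance under a.e. equality comes back
    through positivity of the functional, which is inherited from [m].

    Finiteness of the supremum has two sources. Conjugates are nonnegative, so every member is at
    most [M X^\+]. Supporting [x] at 0 yields an operator of V^S whose conjugate vanishes, so that
    the supremum is at least a real-valued random variable. The same operator gives the lower bounds
    in weak homogeneity and in the projection property. *)

Section HahnBanach.
Context {R : realType} {V : lmodType R}.
Variables (D : set V) (q : V -> R).
Hypotheses (D0 : D 0) (DL : forall a x y, D x -> D y -> D (a *: x + y)).
Hypothesis q_convex : forall x y (l : R), D x -> D y -> 0 <= l <= 1 ->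
  q (l *: x + (1 - l) *: y) <= l * q x + (1 - l) * q y.
Hypothesis q0 : 0 <= q 0.

Definition linear_graph (G : set (V * R)) :=
  (forall a u v, G u -> G v -> G (a *: u.1 + v.1, a * u.2 + v.2)) /\
  (forall u, G u -> D u.1 /\ u.2 <= q u.1).

(** The difference of the two pairs puts [(0, k * (r - s))] in [G] for every [k], and all these
    numbers are bounded by [q 0]. *)
Lemma linear_graph_uniq G x r s :
  linear_graph G -> G (x, r) -> G (x, s) -> r = s.
Proof.
move=> [Glin Gq] Gr Gs.
have G00 : G (0, 0).
  by have := Glin (-1) _ _ Gr Gr; rewrite /= scaleN1r addNr mulN1r addNr.
have Grs k : k * (r - s) <= q 0.
  have := Glin (-1) _ _ Gs Gr; rewrite /= scaleN1r addNr mulN1r => /(Glin k).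
  by move=> /(_ _ G00)/Gq[_]; rewrite /= scaler0 !addr0 addrC.
apply/eqP; rewrite -subr_eq0; apply: contraT => rs0.
have := Grs ((q 0 + 1) / (r - s)); rewrite divfK//; lra.
Qed.

(** The one-dimensional step, for a convex rather than sublinear bound. A value at [z] is admissible
    when it lies above the slopes of [lo], coming from points [u - s z], and below the slopes coming
    from points [w + t z]; the supremum of [lo] is chosen. *)
Lemma linear_graph_extension G z : linear_graph G -> G !=set0 -> D z ->
  exists2 G', linear_graph G' & G `<=` G' /\ exists r, G' (z, r).
Proof.
move=> GG [[x0 r0] Gx0] Dz; have [Glin Gq] := GG.
have G00 : G (0, 0).
  by have := Glin (-1) _ _ Gx0 Gx0; rewrite /= scaleN1r addNr mulN1r addNr.
pose lo := [set x | exists u s, [/\ G u, 0 < s & x = (u.2 - q (u.1 - s *: z)) / s]].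
have lo_up u s w t : G u -> G w -> 0 < s -> 0 < t ->
    (u.2 - q (u.1 - s *: z)) / s <= (q (w.1 + t *: z) - w.2) / t.
  move=> Gu Gw s0 t0.
  have [Du _] := Gq _ Gu; have [Dw _] := Gq _ Gw.
  have st0 : 0 < s + t by lra.
  have stN0 : s + t != 0 by lra.
  (* With weights [t / (s + t)] and [s / (s + t)] the multiples of [z] cancel, so the convex
     combination falls in the domain of [G]. *)
  have l01 : 0 <= t / (s + t) <= 1.
    by rewrite ler_pdivrMr// mul1r lerDr (ltW s0) divr_ge0// ltW.
  have El : 1 - t / (s + t) = s / (s + t) by field.
  have Dus : D (u.1 - s *: z) by rewrite addrC -scaleNr; exact: DL.
  have Dwt : D (w.1 + t *: z) by rewrite addrC; exact: DL.
  have := q_convex Dus Dwt l01; rewrite El.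
  have -> : t / (s + t) *: (u.1 - s *: z) + s / (s + t) *: (w.1 + t *: z) =
      (s + t)^-1 *: (t *: u.1 + s *: w.1).
    rewrite !scalerDr !scalerN !scalerA addrACA.
    rewrite ![_^-1 * _]mulrC [s / _ * t]mulrAC [s * t]mulrC [t / _ * s]mulrAC.
    by rewrite addNr addr0.
  have Gtu : G (t *: u.1 + s *: w.1, t * u.2 + s * w.2).
    by have := Glin t _ _ Gu (Glin s _ _ Gw G00); rewrite /= !addr0.
  have /Gq[_ /=] : G ((s + t)^-1 *: (t *: u.1 + s *: w.1),
      (s + t)^-1 * (t * u.2 + s * w.2)).
    by have := Glin (s + t)^-1 _ _ Gtu G00; rewrite /= !addr0.
  move=> /le_trans/[apply].
  rewrite -![_ / (s + t) * _]mulrA -![_ * ((s + t)^-1 * _)]mulrCA -mulrDr.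
  rewrite ler_pM2l ?invr_gt0// => H.
  rewrite ler_pdivrMr// mulrAC ler_pdivlMr//; lra.
have lo_sup : has_sup lo.
  split; first by exists ((0 - q (0 - 1 *: z)) / 1), (0, 0), 1.
  exists ((q (0 + 1 *: z) - 0) / 1) => _ [u [s [Gu s0 ->]]].
  exact: (lo_up u s (0, 0) 1).
pose c := sup lo.
have cge u s : G u -> 0 < s -> (u.2 - q (u.1 - s *: z)) / s <= c.
  by move=> Gu s0; apply: ub_le_sup; [exact: (proj2 lo_sup)|exists u, s].
have cle w t : G w -> 0 < t -> c <= (q (w.1 + t *: z) - w.2) / t.
  move=> Gw t0; apply: ge_sup; first exact: (proj1 lo_sup).
  by move=> _ [u [s [Gu s0 ->]]]; exact: lo_up.
exists [set w | exists u t, G u /\ w = (u.1 + t *: z, u.2 + t * c)].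
  split.
    move=> a _ _ [u [s [Gu ->]]] [w [t [Gw ->]]] /=.
    exists (a *: u.1 + w.1, a * u.2 + w.2), (a * s + t); split; first exact: Glin.
    congr (_, _); last by rewrite /=; ring.
    by rewrite /= scalerDr addrACA scalerA -scalerDl.
  move=> _ [u [t [Gu ->]]] /=; have [Du qu] := Gq _ Gu; split.
    by rewrite addrC; exact: DL.
  have [t0|t0|->] := ltgtP t 0; last by rewrite mul0r scale0r !addr0.
    have := cge u (- t) Gu; rewrite oppr_gt0 => /(_ t0).
    rewrite scaleNr opprK ler_pdivrMr ?oppr_gt0//; lra.
  by have := cle u t Gu t0; rewrite ler_pdivlMr//; lra.
split.
  by move=> [x r] Gx; exists (x, r), 0; rewrite scale0r mul0r !addr0.
by exists c, (0, 0), 1; rewrite /= scale1r mul1r !add0r.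
Qed.

Theorem Hahn_Banach : exists v : V -> R,
  (forall a x y, D x -> D y -> v (a *: x + y) = a * v x + v y) /\
  (forall x, D x -> v x <= q x).
Proof.
have [F FP Ftot|G [GG Gmax]] := @Zorn_bigcup _ linear_graph.
  split=> [a u v [G1 FG1 G1u] [G2 FG2 G2v]|u [G FG Gu]].
    have [G12|G21] := Ftot _ _ FG1 FG2.
      by exists G2 => //; apply: (proj1 (FP _ FG2)) => //; exact: G12.
    by exists G1 => //; apply: (proj1 (FP _ FG1)) => //; exact: G21.
  exact: (proj2 (FP _ FG)).
(* The empty relation is not maximal: [q 0 >= 0] makes the pair of zeros a larger linear graph. *)
have G0 : G !=set0.
  apply/set0P/negP => /eqP G0.
  apply: (Gmax [set (0 : V, 0 : R)]); last first.
    split=> [a u v -> ->|u ->] //=; first by rewrite scaler0 mulr0 !addr0.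
  by rewrite G0; split=> [//|/(_ (0, 0))]; exact.
have Gtot z : D z -> exists r, G (z, r).
  move=> Dz; have [G' G'G [GG' [r Gr]]] := linear_graph_extension GG G0 Dz.
  have [G'sG|G'NG] := pselect (G' `<=` G); first by exists r; exact: G'sG.
  by exfalso; exact: (Gmax G').
pose v z := xget 0 [set r | G (z, r)].
have Gv z : D z -> G (z, v z).
  by move=> /Gtot[r Gr]; rewrite /v; case: xgetP => [s -> //|/(_ _ Gr)].
exists v; split=> [a x y Dx Dy|x Dx].
  have := proj1 GG a _ _ (Gv _ Dx) (Gv _ Dy) => /=.
  by apply: linear_graph_uniq (Gv _ _) => //; exact: DL.
exact: (proj2 (proj2 GG _ (Gv _ Dx))).
Qed.

End HahnBanach.

(** * Linear functionals between a superlinear and a sublinear bound, supporting a convex one *)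

Section SandwichFunctional.
Context {R : realType} {V : lmodType R}.
Variables (D C L : set V) (F m M : V -> R).
Hypotheses (D0 : D 0) (DL : forall a x y, D x -> D y -> D (a *: x + y)).
Hypotheses (CD : C `<=` D) (CD_gen : forall x, D x -> exists2 y, C y & C (y - x)).
Hypotheses (CA : forall x y, C x -> C y -> C (x + y))
  (CZ : forall (a : R) x, 0 <= a -> C x -> C (a *: x)).
Hypotheses (LD : L `<=` D) (L0 : L 0)
  (LL : forall a x y, L x -> L y -> L (a *: x + y)).
Hypothesis F_convex : forall x y (l : R), L x -> L y -> 0 <= l <= 1 ->
  F (l *: x + (1 - l) *: y) <= l * F x + (1 - l) * F y.
Hypotheses (mA : forall x y, C x -> C y -> m x + m y <= m (x + y))
  (mZ : forall (a : R) x, C x -> 0 <= a -> m (a *: x) = a * m x).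
Hypotheses (MA : forall x y, C x -> C y -> M (x + y) <= M x + M y)
  (MZ : forall (a : R) x, C x -> 0 <= a -> M (a *: x) = a * M x).
Hypothesis sandwichF : forall x y z, L x -> C y -> C z ->
  C (y - z - x) -> m z + F x <= M y.

Let LZ a x : L x -> L (a *: x).
Proof. by move=> Lx; rewrite -[_ *: _]addr0; exact: LL. Qed.

Let LB x y : L x -> L y -> L (x - y).
Proof. by move=> Lx Ly; rewrite addrC -scaleN1r; exact: LL. Qed.

Let C0 : C 0.
Proof.
by have [y Cy _] := CD_gen D0; rewrite -(scale0r y); exact: CZ.
Qed.

Let m0 : m 0 = 0. Proof. by rewrite -(scale0r 0) mZ// mul0r. Qed.
Let M0 : M 0 = 0. Proof. by rewrite -(scale0r 0) MZ// mul0r. Qed.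

(* Writing [x] as a convex combination of [(1 - 1/t) x] and [2 x], and
   [(1 - 1/t) x] as one of [(t - 1) (x - x')] and [x'], the homogeneity of [m]
   and [M] gives the claim up to an error of order [1/t]. *)
Lemma sandwich_difference x x' y z : L x -> L x' -> C y -> C z ->
  C (x' + y - z - x) -> F x <= F x' + M y - m z.
Proof.
move=> Lx Lx' Cy Cz Cxyz; set K := F x' + M y - m z.
(* Here [s] is [t - 1]. The bound reads [s * (F x - K) <= F (2 *: x) - 2 * F x], with a right-hand
   side independent of [s]. *)
have bound s : 0 < s -> (s + 2) * F x <= s * K + F (2 *: x).
  move=> s0; have Ls : L (s *: (x - x')) by apply/LZ/LB.
  have /(sandwichF Ls (CZ (ltW s0) Cy) (CZ (ltW s0) Cz)) :
      C (s *: y - s *: z - s *: (x - x')).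
    rewrite -!scalerBr; apply: CZ (ltW s0) _.
    by rewrite opprB addrA addrAC addrC !addrA addrAC in Cxyz *.
  rewrite mZ ?(ltW s0)// MZ ?(ltW s0)// => H1.
  have s1 : s + 1 != 0 by rewrite gt_eqF// ltr_wpDl// ltW.
  have s2 : s + 2 != 0 by rewrite gt_eqF// ltr_wpDl// ltW.
  have l1 : 0 <= (s + 1)^-1 <= 1 by rewrite invr_ge0 invf_le1; lra.
  have l2 : 0 <= (s + 1) / (s + 2) <= 1.
    by rewrite divr_ge0 ?ler_pdivrMr; lra.
  have := F_convex Ls Lx' l1.
  have -> : (s + 1)^-1 *: (s *: (x - x')) + (1 - (s + 1)^-1) *: x' =
      (s / (s + 1)) *: x.
    have -> : 1 - (s + 1)^-1 = s / (s + 1) by field.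
    by rewrite scalerA [_^-1 * s]mulrC -scalerDr subrK.
  move=> H2.
  have := F_convex (LZ (s / (s + 1)) Lx) (LZ 2 Lx) l2.
  have -> : (s + 1) / (s + 2) *: (s / (s + 1) *: x) +
      (1 - (s + 1) / (s + 2)) *: (2 *: x) = x.
    rewrite !scalerA -scalerDl -[RHS]scale1r; congr (_ *: _).
    by field; rewrite s1 s2.
  move=> H3.
  have H2' : (s + 1) * F (s / (s + 1) *: x) <= F (s *: (x - x')) + s * F x'.
    rewrite mulrC -ler_pdivlMr; last by lra.
    apply: (le_trans H2); rewrite le_eqVlt; apply/orP; left; apply/eqP.
    by field.
  have H3' : (s + 2) * F x <= (s + 1) * F (s / (s + 1) *: x) + F (2 *: x).
    rewrite mulrC -ler_pdivlMr; last by lra.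
    apply: (le_trans H3); rewrite le_eqVlt; apply/orP; left; apply/eqP.
    by field.
  rewrite /K; lra.
rewrite leNgt; apply/negP => KF.
(* For this [s] the product [s * (F x - K)] exceeds the constant error by at least 1. *)
have := bound ((`|F (2 *: x) - 2 * F x| + 1) / (F x - K)).
rewrite divr_gt0 ?subr_gt0// => /(_ isT).
set s := _ / _.
have : s * (F x - K) = `|F (2 *: x) - 2 * F x| + 1.
  by rewrite divfK// subr_eq0 gt_eqF.
have := ler_norm (F (2 *: x) - 2 * F x).
lra.
Qed.

Lemma sandwich_functional x0 : L x0 -> exists v : V -> R,
  [/\ forall a x y, D x -> D y -> v (a *: x + y) = a * v x + v y,
      forall z, C z -> m z <= v z /\ v z <= M z
    & forall x, L x -> v x - F x <= v x0 - F x0].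
Proof.
move=> Lx0.
(* The values whose infimum is the infimal convolution at [w]; the decomposition [x + y - z] only
   has to dominate [w] in the order of the cone [C]. *)
pose S w := [set r | exists x y z, [/\ L x, C y, C z, C (x + y - z - w)
  & r = F (x0 + x) - F x0 + M y - m z]].
have LA x y : L x -> L y -> L (x + y).
  by move=> Lx Ly; rewrite -[x]scale1r; exact: LL.
(* Convexity is stated for the sets of values, because it is needed to bound them from below before
   their infima make sense. *)
have Sconv w w' (l : R) r r' : 0 <= l <= 1 -> S w r -> S w' r' ->
    exists2 r'', S (l *: w + (1 - l) *: w') r'' & r'' <= l * r + (1 - l) * r'.
  move=> l01 [x [y [z [Lx Cy Cz Cw ->]]]] [x' [y' [z' [Lx' Cy' Cz' Cw' ->]]]].
  have [l0 l1] : 0 <= l /\ 0 <= 1 - l by lra.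
  exists (F (x0 + (l *: x + (1 - l) *: x')) - F x0
      + M (l *: y + (1 - l) *: y') - m (l *: z + (1 - l) *: z')).
    exists (l *: x + (1 - l) *: x'), (l *: y + (1 - l) *: y'),
      (l *: z + (1 - l) *: z'); split => //; do ?exact: LL (LZ _ _);
      do 2?by apply: CA; exact: CZ.
    have -> : l *: x + (1 - l) *: x' + (l *: y + (1 - l) *: y') -
        (l *: z + (1 - l) *: z') - (l *: w + (1 - l) *: w') =
        l *: (x + y - z - w) + (1 - l) *: (x' + y' - z' - w').
      rewrite (addrACA _ _ (l *: y)) -!scalerDr opprD addrACA -!scalerBr.
      by rewrite opprD addrACA -!scalerBr.
    by apply: CA; exact: CZ.
  have := F_convex (LA _ _ Lx0 Lx) (LA _ _ Lx0 Lx') l01.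
  have -> : l *: (x0 + x) + (1 - l) *: (x0 + x') =
      x0 + (l *: x + (1 - l) *: x').
    by rewrite !scalerDr addrACA -scalerDl [l + _]addrC subrK scale1r.
  have := MA (CZ l0 Cy) (CZ l1 Cy'); rewrite !MZ//.
  have := mA (CZ l0 Cz) (CZ l1 Cz'); rewrite !mZ//.
  lra.
have S0 r : S 0 r -> 0 <= r.
  move=> [x [y [z [Lx Cy Cz Cw ->]]]].
  suff : F x0 <= F (x0 + x) + M y - m z by lra.
  apply: sandwich_difference => //; first exact: LA.
  by rewrite subr0 in Cw; rewrite addrC !addrA addNr add0r.
have Sne w : D w -> S w !=set0.
  move=> /CD_gen[y Cy Cyw].
  exists (F (x0 + 0) - F x0 + M y - m 0), 0, y, 0; split => //.
  by rewrite add0r subr0.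
(* The midpoint of a value at [w] and a value at [- w] dominates a value at 0, which is nonnegative;
   one fixed value at [- w] therefore bounds [S w] from below. *)
have Slb w : D w -> has_lbound (S w).
  move=> Dw; have [r' Sr'] : S (- w) !=set0.
    by apply: Sne; rewrite -[- w]addr0 -scaleN1r; exact: DL.
  exists (- r') => r Sr.
  have h01 : 0 <= (2^-1 : R) <= 1 by lra.
  have [r'' Sr'' le''] := Sconv _ _ _ _ _ h01 Sr Sr'.
  have /S0 : S 0 r''.
    move: Sr''; have -> : 1 - 2^-1 = 2^-1 :> R by lra.
    by rewrite scalerN subrr.
  lra.
pose q w := inf (S w).
have qle w r : D w -> S w r -> q w <= r.
  by move=> /Slb Sw Sr; exact: ge_inf.
have [||v [vL vq]] := @Hahn_Banach _ _ D q D0 DL.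
- move=> w w' l Dw Dw' l01.
  have Dww' : D (l *: w + (1 - l) *: w').
    by apply: DL => //; rewrite -[X in D X]addr0; exact: DL.
  have [l0 l1] : 0 <= l /\ 0 <= 1 - l by lra.
  apply/ler_addgt0Pr => e e0.
  have [r Sr re] := inf_adherent e0 (conj (Sne _ Dw) (Slb _ Dw)).
  have [r' Sr' re'] := inf_adherent e0 (conj (Sne _ Dw') (Slb _ Dw')).
  have [r'' Sr'' le''] := Sconv _ _ _ _ _ l01 Sr Sr'.
  apply: (le_trans (qle _ _ Dww' Sr'')); apply: (le_trans le'').
  have := ler_wpM2l l0 (ltW re); have := ler_wpM2l l1 (ltW re').
  rewrite /q; lra.
- exact: lb_le_inf (Sne _ D0) S0.
(* The three bounds come from testing [v <= q] at [- z], [z] and [x - x0], each time with a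
   decomposition that has a single nonzero term. *)
exists v; split=> [//|z Cz|x Lx].
  have v0 : v 0 = 0.
    by have := vL (-1) 0 0 D0 D0; rewrite scaler0 addr0; lra.
  split.
    have Dz : D (- z) by rewrite -[- z]addr0 -scaleN1r; apply: DL => //; exact: CD.
    have : q (- z) <= F (x0 + 0) - F x0 + M 0 - m z.
      apply: qle => //; exists 0, 0, z; split => //.
      by rewrite opprK addr0 sub0r addNr.
    have := vq _ Dz; have := vL (-1) _ _ (CD Cz) D0.
    rewrite scaleN1r !addr0 v0 M0; lra.
  have : q z <= F (x0 + 0) - F x0 + M z - m 0.
    apply: qle; first exact: CD.
    by exists 0, z, 0; split => //; rewrite add0r subr0 subrr.
  by have := vq _ (CD Cz); rewrite addr0 m0; lra.
have : q (x - x0) <= F (x0 + (x - x0)) - F x0 + M 0 - m 0.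
  apply: qle; first by apply: LD; exact: LB.
  exists (x - x0), 0, 0; split => //; first exact: LB.
  by rewrite addr0 subr0 subrr.
have := vq _ (LD (LB Lx Lx0)).
have := vL (-1) _ _ (LD Lx0) (LD Lx); rewrite scaleN1r [- _ + _]addrC => ->.
by rewrite addrCA subrr addr0 M0 m0; lra.
Qed.

End SandwichFunctional.

(** * Measurability, expectation and L_p spaces relative to a sub-sigma-algebra *)

Local Notation mf F :=
  (@measurable_fun _ _ (g_sigma_algebraType F) _ [set: g_sigma_algebraType F]).

Lemma cvg_indic_decreasing {T : Type} {R : realType} (H_ : nat -> set T) :
  (forall n, H_ n.+1 `<=` H_ n) -> \bigcap_n H_ n = set0 ->
  forall t, \1_(H_ n) t @[n --> \oo] --> (0 : R).
Proof.
move=> Hdec H0 t.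
have [N nN] : exists N, ~ H_ N t.
  apply: contrapT => /forallNP Ht; have : (\bigcap_n H_ n) t.
    by move=> n _; apply: contrapT; exact: Ht.
  by rewrite H0.
apply: cvg_near_cst; exists N => // n /= Nn.
rewrite indicE memNset// => Hn; apply: nN.
elim: n Nn Hn => [|n IHn]; first by rewrite leqn0 => /eqP ->.
by rewrite leq_eqVlt ltnS => /predU1P[<- //|/IHn{}IHn /Hdec/IHn].
Qed.

Section SubSigmaAlgebra.
Context {d : measure_display} {T : measurableType d} {R : realType}.
Variable P : probability T R.
Implicit Types F : set (set T).

(** What the ambient sigma-algebra and [A] have in common. Containing the null sets makes
    measurability for [F] invariant under a.e. equality. *)
Definition complete_subalgebra F :=
  [/\ sigma_algebra [set: T] F, F `<=` d.-measurable & P.-negligible `<=` F].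

Lemma measurable_subalgebra F (H : set T) : sigma_algebra [set: T] F ->
  F H <-> measurable (H : set (g_sigma_algebraType F)).
Proof. by move=> sF; rewrite /measurable/= sigma_algebra_id. Qed.

Lemma measurable_complete_subalgebra : measure_is_complete P ->
  complete_subalgebra d.-measurable.
Proof.
by move=> cP; split => //; exact: sigma_algebra_measurable.
Qed.

Lemma augmented_complete_subalgebra F : measure_is_complete P ->
  augmented_countably_generated P F -> complete_subalgebra F.
Proof.
move=> cP [G [_ Gm ->]]; split; first exact: smallest_sigma_algebra.
  apply: smallest_sub; first exact: sigma_algebra_measurable.
  by move=> H [/Gm|/cP].
by move=> N PN; apply: sub_sigma_algebra; right.
Qed.

Section fix_F.
Variable F : set (set T).
Hypothesis cF : complete_subalgebra F.

Let sF : sigma_algebra [set: T] F. Proof. by case: cF. Qed.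

Let mS (H : set T) : F H <-> measurable (H : set (g_sigma_algebraType F)).
Proof. exact: measurable_subalgebra. Qed.

Lemma subalgebraP d' (U : measurableType d') (X : T -> U) :
  mf F X <-> forall B, measurable B -> F (X @^-1` B).
Proof.
split=> [mX B mB|FX].
  by apply/mS; rewrite -[X in measurable X]setTI; exact: mX.
by move=> _ B mB; rewrite setTI; apply/mS; exact: FX.
Qed.

Lemma subalgebra_measurable_fun d' (U : measurableType d') (X : T -> U) :
  mf F X -> measurable_fun [set: T] X.
Proof.
by move=> /subalgebraP FX _ B mB; rewrite setTI; case: cF => _ + _; apply; exact: FX.
Qed.

Lemma subalgebraI (H K : set T) : F H -> F K -> F (H `&` K).
Proof. by move=> /mS mH /mS mK; apply/mS; exact: measurableI. Qed.

Lemma subalgebraC (H : set T) : F H -> F (~` H).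
Proof. by move=> /mS mH; apply/mS; exact: measurableC. Qed.

Lemma subalgebraT : F [set: T].
Proof. exact/mS. Qed.

(** The two preimages of [B] differ only inside the null set [N], all of whose subsets belong to
    [F]. *)
Lemma ae_eq_subalgebra d' (U : measurableType d') (X Y : T -> U) :
  (\forall t \ae P, X t = Y t) -> mf F X -> mf F Y.
Proof.
move=> XY /subalgebraP FX; apply/subalgebraP => B mB.
set N := ~` [set t | X t = Y t].
have FN H : H `<=` N -> F H.
  by move=> HN; case: cF => _ _; apply; exact: negligibleS XY.
have -> : Y @^-1` B = (X @^-1` B `&` ~` N) `|` (Y @^-1` B `&` N).
  apply/seteqP; split=> t /=; rewrite /N/=.
    by have [->|XYt] := eqVneq (X t) (Y t); [left; split|right; split=> //; exact/eqP].
  by move=> [[BX /contrapT <-]|[]].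
apply/mS; apply: measurableU; apply/mS.
  by apply: subalgebraI; [exact: FX|exact/subalgebraC/FN].
by apply: FN => t [].
Qed.

Lemma subalgebra_indic (H : set T) : F H -> mf F (\1_H : T -> R).
Proof.
by move=> FH; apply: measurable_indic; exact/mS.
Qed.

Lemma subalgebra_lt (X Y : T -> R) : mf F X -> mf F Y -> F [set t | X t < Y t].
Proof.
move=> mX mY; apply/mS.
rewrite -[X in measurable X]setTI.
have := @measurable_lte _ (g_sigma_algebraType F) R _ measurableT (EFin \o X) (EFin \o Y).
under eq_set do rewrite /= lte_fin.
by apply; exact/measurable_EFinP.
Qed.

Lemma subalgebra_mf_all (X : T -> R) : measurable_fun [set: T] X -> mf d.-measurable X.
Proof.
move=> mX _ B mB; rewrite setTI; apply: sub_sigma_algebra.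
by rewrite -[X in measurable X]setTI; exact: mX.
Qed.

End fix_F.
End SubSigmaAlgebra.

(** * Integrable random variables and their expectation as a real number *)

Section Expectation.
Context {d : measure_display} {T : measurableType d} {R : realType}.
Variable P : probability T R.
Implicit Types (X Y Z : T -> R).

Definition L1 X := P.-integrable [set: T] (EFin \o X).

Definition Ev X : R := \int[P]_t X t.

Lemma L1_measurable X : L1 X -> measurable_fun [set: T] X.
Proof. by move=> /measurable_int/measurable_EFinP. Qed.

Lemma L1L a X Y : L1 X -> L1 Y -> L1 (a \*: X \+ Y).
Proof.
move=> iX iY; rewrite /L1 (_ : EFin \o _ =
  (fun t => a%:E * (EFin \o X) t) \+ (EFin \o Y))%E//.
by apply: integrableD => //; exact: integrableZl.
Qed.

Lemma EvL a X Y : L1 X -> L1 Y -> Ev (a \*: X \+ Y) = a * Ev X + Ev Y.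
Proof.
move=> iX iY; rewrite /Ev/= RintegralD//; last first.
  rewrite (_ : EFin \o _ = (fun t => a%:E * (EFin \o X) t))%E//.
  exact: integrableZl.
by rewrite RintegralZl.
Qed.

Lemma L1_cst (c : R) : L1 (cst c).
Proof. exact: finite_measure_integrable_cst. Qed.

Lemma L1Z a X : L1 X -> L1 (a \*: X).
Proof.
move=> iX; have := L1L a iX (L1_cst 0); congr L1.
by apply/funext => t /=; rewrite addr0.
Qed.

Lemma EvZ a X : L1 X -> Ev (a \*: X) = a * Ev X.
Proof. by move=> iX; rewrite /Ev RintegralZl. Qed.

Lemma L1D X Y : L1 X -> L1 Y -> L1 (X \+ Y).
Proof.
move=> iX iY; have := L1L 1 iX iY; congr L1.
by apply/funext => t /=; rewrite scale1r.
Qed.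

Lemma EvD X Y : L1 X -> L1 Y -> Ev (X \+ Y) = Ev X + Ev Y.
Proof. by move=> iX iY; rewrite /Ev RintegralD. Qed.

Lemma L1B X Y : L1 X -> L1 Y -> L1 (X \- Y).
Proof.
move=> iX iY; have := L1L (-1) iY iX; congr L1.
by apply/funext => t /=; rewrite scaleN1r addrC.
Qed.

Lemma EvB X Y : L1 X -> L1 Y -> Ev (X \- Y) = Ev X - Ev Y.
Proof. by move=> iX iY; rewrite /Ev RintegralB. Qed.

Lemma L1_dominated X Y : measurable_fun [set: T] X -> L1 Y ->
  (\forall t \ae P, `|X t| <= `|Y t|) -> L1 X.
Proof.
move=> mX iY XY; apply/integrableP; split; first exact/measurable_EFinP.
move/integrableP : iY => [mY]; apply: le_lt_trans.
apply: ae_ge0_le_integral => //; try exact: measurableT_comp.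
- by apply: measurableT_comp => //; exact/measurable_EFinP.
- by move: XY; apply: filterS => t /=; rewrite lee_fin.
Qed.

Lemma L1_eq_ae X Y : measurable_fun [set: T] Y -> L1 X -> (\forall t \ae P, X t = Y t) -> L1 Y.
Proof.
by move=> mY iX XY; apply: (L1_dominated mY iX); move: XY; apply: filterS => t ->.
Qed.

Lemma L1_indic (H : set T) X : measurable H -> L1 X -> L1 (\1_H \* X).
Proof.
move=> mH iX; apply: (L1_dominated _ iX).
  by apply: measurable_funM => //; exact: L1_measurable.
apply: aeW => t /=; rewrite normrM indicE; case: (t \in H).
  by rewrite normr1 mul1r.
by rewrite normr0 mul0r.
Qed.

Lemma Ev_ge0 X : L1 X -> ae_le P (cst 0) X -> 0 <= Ev X.
Proof.
move=> iX X0; rewrite /Ev /Rintegral (@ae_eq_integral _ _ _ P _ (EFin \o (fun t => `|X t|)))//.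
- by apply: fine_ge0; apply: integral_ge0 => t _; rewrite lee_fin.
- exact: measurable_int iX.
- by apply/measurable_EFinP; apply: measurableT_comp => //; exact: L1_measurable.
- by move: X0; apply: filterS => t /= X0 _; rewrite ger0_norm.
Qed.

Lemma le_Ev X Y : L1 X -> L1 Y -> ae_le P X Y -> Ev X <= Ev Y.
Proof.
move=> iX iY XY; rewrite -subr_ge0 -EvB//; apply: Ev_ge0; first exact: L1B.
by move: XY; apply: filterS => t /=; rewrite subr_ge0.
Qed.

Lemma eq_Ev X Y : L1 X -> L1 Y -> (\forall t \ae P, X t = Y t) -> Ev X = Ev Y.
Proof.
move=> iX iY XY; apply/eqP; rewrite eq_le !le_Ev//.
  by move: XY; apply: filterS => t ->.
by move: XY; apply: filterS => t ->.
Qed.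

Lemma Ev_eq0 X : L1 X -> ae_le P (cst 0) X -> Ev X <= 0 ->
  \forall t \ae P, X t = 0.
Proof.
move=> iX X0 EX; have mX := measurable_int _ iX.
have /(ae_eq_integral_abs P measurableT mX) :
    (\int[P]_t `|(EFin \o X) t| = 0)%E; last first.
  by apply: filterS => t /= /(_ I) [].
have EX0 : Ev X = 0 by apply/eqP; rewrite eq_le EX Ev_ge0.
rewrite (@ae_eq_integral _ _ _ P _ (EFin \o X))//.
- rewrite -[LHS]fineK; last exact: integrable_fin_num.
  by rewrite -[fine _]/(Ev X) EX0.
- exact: measurableT_comp.
- by move: X0; apply: filterS => t /= X0 _; rewrite ger0_norm.
Qed.

(** A single test set suffices: the set where [Y < X], which is in [F] because both variables are
    measurable for [F]. *)
Lemma ae_le_of_Ev F X Y : complete_subalgebra P F -> mf F X -> mf F Y ->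
  L1 X -> L1 Y ->
  (forall H, F H -> Ev (\1_H \* X) <= Ev (\1_H \* Y)) -> ae_le P X Y.
Proof.
move=> cF mX mY iX iY XY.
have FH := subalgebra_lt cF mY mX; set H := [set t | _] in FH.
have mH : measurable H by case: cF => _ + _; apply.
have HD : \1_H \* (X \- Y) = (\1_H \* X) \- (\1_H \* Y).
  by apply/funext => t /=; rewrite mulrBr.
have iXY : L1 (\1_H \* (X \- Y)) by apply: L1_indic => //; exact: L1B.
have := Ev_eq0 iXY; rewrite HD EvB; try exact: L1_indic.
rewrite subr_le0 XY// -HD => XY0.
have {XY0} : \forall t \ae P, (\1_H \* (X \- Y)) t = 0.
  apply: XY0 => //; apply: aeW => t /=; rewrite indicE.
  have [|] := boolP (t \in H); rewrite ?mul0r// mul1r inE /H/= subr_ge0.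
  exact: ltW.
apply: filterS => t /=; rewrite indicE.
have [|/negP] := boolP (t \in H); rewrite inE/H/=.
  by rewrite mul1r => YX /eqP; rewrite subr_eq0 => /eqP ->.
by move=> /negP; rewrite -leNgt.
Qed.

Lemma cvg_Ev0 (X_ : nat -> T -> R) Y : (forall n, measurable_fun [set: T] (X_ n)) ->
  L1 Y -> (forall n, \forall t \ae P, `|X_ n t| <= Y t) ->
  ae_cvg P X_ (cst 0) -> Ev (X_ n) @[n --> \oo] --> 0.
Proof.
move=> mX iY XY X0.
have [||||_ _ c] := @dominated_convergence _ _ _ P _ measurableT
  (fun n => EFin \o X_ n) (cst 0%E) (EFin \o Y) _ _ _ iY.
- by move=> n; exact/measurable_EFinP.
- exact: measurable_cst.
- move: X0; apply: filterS => t /= X0 _.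
  by apply: cvg_EFin; [exact: nearW|exact: X0].
- move: (ae_foralln XY); apply: filterS => t /= XYt n _; rewrite lee_fin; exact: XYt.
have : fine (\int[P]_t (EFin \o X_ n) t)%E @[n --> \oo] --> (0 : R).
  by move: c; rewrite integral0 => /fine_cvgP[].
exact.
Qed.

End Expectation.

Lemma in_LfunP {d : measure_display} {T : measurableType d} {R : realType}
    (P : probability T R) (p : \bar R) (X : T -> R) : X \in Lfun P p <->
  measurable_fun [set: T] X /\ ('N[P]_p[EFin \o X] < +oo)%E.
Proof.
split=> [|[mX fX]].
  by rewrite inE => /andP[/[!inE]].
by rewrite inE; apply/andP; split; rewrite inE.
Qed.

(** * Order and domination in L_p spaces *)

Section LpFacts.
Context {d : measure_display} {T : measurableType d} {R : realType}.
Variables (P : probability T R) (p : \bar R).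
Hypothesis p1 : (1 <= p)%E.
Implicit Types (X Y Z : T -> R) (F : set (set T)).

Lemma le_Lnorm_ae X Y : measurable_fun [set: T] X -> measurable_fun [set: T] Y ->
  (\forall t \ae P, `|X t| <= `|Y t|) ->
  ('N[P]_p[EFin \o X] <= 'N[P]_p[EFin \o Y])%E.
Proof.
move=> mX mY XY; rewrite unlock /Lnorm; case: p p1 => [r| |//].
  rewrite lee_fin => r1.
  apply: gt0_ler_poweR; rewrite ?invr_ge0 ?(le_trans ler01)//.
  - by rewrite in_itv/= leey andbT integral_ge0// => t _; rewrite poweR_ge0.
  - by rewrite in_itv/= leey andbT integral_ge0// => t _; rewrite poweR_ge0.
  have mr Z : measurable_fun [set: T] Z ->
      measurable_fun [set: T] (fun t => `|(EFin \o Z) t| `^ r)%E.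
    move=> mZ; apply: (@measurableT_comp _ _ _ _ _ _ (fun x => x `^ r)%E) => //.
      exact: measurable_poweR.
    by do 2 apply: measurableT_comp => //.
  apply: ae_ge0_le_integral => //; do ?[exact: mr|by move=> t _; exact: poweR_ge0].
  move: XY; apply: filterS => t /= XYt _.
  by rewrite lee_fin ge0_ler_powR// ?nnegrE// (le_trans ler01).
move=> _; case: ifPn => // _; apply: ess_sup_inf.le_ess_sup.
by move: XY; apply: filterS => t /=; rewrite lee_fin.
Qed.

Lemma Lp_mf F X : Lp P F p X -> mf F X. Proof. by case. Qed.

Lemma Lp_measurable F X : Lp P F p X -> measurable_fun [set: T] X.
Proof. by case => /in_LfunP[]. Qed.

Lemma LpT F X : Lp P F p X -> Lp P d.-measurable p X.
Proof.
move=> FX; have mX := Lp_measurable FX; case: FX => FX _; split => //.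
exact: subalgebra_mf_all.
Qed.

Lemma Lp_L1 F X : Lp P F p X -> L1 P X.
Proof.
move=> [FX _]; apply/Lfun1_integrable; apply: (Lfun_subset _ p1 _ p1) => //.
by rewrite fin_num_measure.
Qed.

(** The two sigma-algebras may differ: only the norm is taken from [X], so a bound in one L_p space
    also places [Y] in the other. *)
Lemma Lp_dominated F F' X Y : complete_subalgebra P F' -> Lp P F p X -> mf F' Y ->
  (\forall t \ae P, `|Y t| <= `|X t|) -> Lp P F' p Y.
Proof.
move=> cF' FX mY YX; have m'Y := subalgebra_measurable_fun cF' mY.
split => //; apply/in_LfunP; split => //.
case: FX => /in_LfunP[mX fX] _; apply: le_lt_trans fX.
exact: le_Lnorm_ae.
Qed.

Lemma LpL F a X Y : Lp P F p X -> Lp P F p Y -> Lp P F p (a \*: X \+ Y).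
Proof.
move=> [lX mX] [lY mY]; split.
  by have [_ /(_ a X Y lX lY)] := Lfun_submod_closed P p1.
by apply: measurable_funD => //; exact: measurable_funM.
Qed.

Lemma Lp_cst F (c : R) : complete_subalgebra P F -> Lp P F p (cst c).
Proof.
move=> cF; split; last exact: measurable_cst.
case: p p1 => [r r1||//]; first exact: Lfun_cst.
move=> _; apply/in_LfunP; split=> //; rewrite unlock /Lnorm; case: ifPn => // P0.
by rewrite (_ : abse \o _ = cst `|c|%:E)// ess_sup_inf.ess_sup_cst// ltry.
Qed.

Lemma LpZ F a X : complete_subalgebra P F -> Lp P F p X -> Lp P F p (a \*: X).
Proof.
move=> cF FX; have := LpL a FX (Lp_cst 0 cF); congr (Lp P F p).
by apply/funext => t /=; rewrite addr0.
Qed.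

Lemma LpD F X Y : Lp P F p X -> Lp P F p Y -> Lp P F p (X \+ Y).
Proof.
move=> FX FY; have := LpL 1 FX FY; congr (Lp P F p).
by apply/funext => t /=; rewrite scale1r.
Qed.

Lemma LpB F X Y : Lp P F p X -> Lp P F p Y -> Lp P F p (X \- Y).
Proof.
move=> FX FY; have := LpL (-1) FY FX; congr (Lp P F p).
by apply/funext => t /=; rewrite scaleN1r addrC.
Qed.

Lemma Lp_indicM F (H : set T) X : complete_subalgebra P F -> F H ->
  Lp P F p X -> Lp P F p (\1_H \* X).
Proof.
move=> cF FH FX; apply: (Lp_dominated cF FX).
  apply: (@measurable_funM _ (g_sigma_algebraType F)).
    by have := subalgebra_indic cF FH; exact.
  exact: Lp_mf FX.
apply: aeW => t /=; rewrite normrM indicE; case: (t \in H).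
  by rewrite normr1 mul1r.
by rewrite normr0 mul0r.
Qed.

Lemma Lp_normr F X : complete_subalgebra P F -> Lp P F p X -> Lp P F p (fun t => `|X t|).
Proof.
move=> cF FX; apply: (Lp_dominated cF FX).
  by apply: (@measurableT_comp _ _ _ (g_sigma_algebraType F)) => //; exact: Lp_mf FX.
by apply: aeW => t /=; rewrite normr_id.
Qed.

Lemma Lp_funrpos F X : complete_subalgebra P F -> Lp P F p X -> Lp_nneg P F p X^\+.
Proof.
move=> cF FX; split; last by apply: aeW => t; exact: funrpos_ge0.
apply: (Lp_dominated cF FX); first by apply: measurable_funrpos; exact: Lp_mf FX.
apply: aeW => t; rewrite ger0_norm ?funrpos_ge0// /funrpos.
by rewrite ge_max ler_norm normr_ge0.
Qed.

Lemma Lp_funrneg F X : complete_subalgebra P F -> Lp P F p X -> Lp_nneg P F p X^\-.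
Proof.
move=> cF FX; split; last by apply: aeW => t; exact: funrneg_ge0.
apply: (Lp_dominated cF FX); first by apply: measurable_funrneg; exact: Lp_mf FX.
apply: aeW => t; rewrite ger0_norm ?funrneg_ge0// /funrneg.
by rewrite ge_max -normrN ler_norm normr_ge0.
Qed.

Lemma Lp_nnegD F X Y : Lp_nneg P F p X -> Lp_nneg P F p Y -> Lp_nneg P F p (X \+ Y).
Proof.
move=> [lX X0] [lY Y0]; split; first exact: LpD.
by move: X0 Y0; apply: filterS2 => t /= X0 Y0; rewrite addr_ge0.
Qed.

Lemma Lp_nnegZ F a X : complete_subalgebra P F -> 0 <= a ->
  Lp_nneg P F p X -> Lp_nneg P F p (a \*: X).
Proof.
move=> cF a0 [lX X0]; split; first exact: LpZ.
by move: X0; apply: filterS => t /= X0; rewrite mulr_ge0.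
Qed.

Lemma Lp_nneg_indicM F (H : set T) X : complete_subalgebra P F -> F H ->
  Lp_nneg P F p X -> Lp_nneg P F p (\1_H \* X).
Proof.
move=> cF FH [lX X0]; split; first exact: Lp_indicM.
by move: X0; apply: filterS => t /= X0; rewrite mulr_ge0// indicE.
Qed.

(** Hoelder's inequality against the constant 1, whose norms are all 1 for a probability. *)
Lemma Lnorm1_le X : p != +oo%E -> measurable_fun [set: T] X ->
  ('N[P]_1[EFin \o X] <= 'N[P]_p[EFin \o X])%E.
Proof.
case: p p1 => [r| |//]; rewrite ?eqxx// lee_fin => r1 _ mX.
have [<-//|rN1] := eqVneq 1 r.
have r_gt1 : 1 < r by rewrite lt_neqAle rN1.
have r0 : 0 < r by rewrite (lt_trans ltr01).
have rV1 : r^-1 < 1 by rewrite invf_lt1.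
have q0 : 0 < (1 - r^-1)^-1 by rewrite invr_gt0 subr_gt0.
have := @hoelder _ _ _ P X (cst 1) r _ mX (measurable_cst _) r0 q0.
rewrite invrK addrC subrK => /(_ erefl).
rewrite (_ : X \* cst 1 = X); last by apply/funext => t /=; rewrite mulr1.
rewrite Lnorm_cst1 [X in (X `^ _)%E](_ : _ = 1%E) ?poweR1r ?mule1//.
exact: probability_setT.
Qed.

End LpFacts.

(** * Conditional operators of positive functionals *)

Section RadonNikodym.
Context {d : measure_display} {T : measurableType d} {R : realType}.
Variables (P : probability T R) (F : set (set T)).
Hypothesis cF : complete_subalgebra P F.
Variable rho : set T -> R.
Hypothesis rho_additive : forall H K, F H -> F K -> H `&` K = set0 ->
  rho (H `|` K) = rho H + rho K.
Hypothesis rho_continuous : forall H_ : nat -> set T, (forall n, F (H_ n)) ->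
  (forall n, H_ n.+1 `<=` H_ n) -> \bigcap_n H_ n = set0 ->
  rho (H_ n) @[n --> \oo] --> 0.
Hypothesis rho_null : forall H, F H -> P H = 0%E -> rho H = 0.

Let TF := g_sigma_algebraType F.

Let sF : sigma_algebra [set: T] F. Proof. by case: cF. Qed.

Let FS (H : set T) : F H <-> measurable (H : set TF).
Proof. exact: measurable_subalgebra. Qed.

Let idF : T -> TF := id.

Let mid : measurable_fun [set: T] idF.
Proof.
by move=> _ B /FS FB; rewrite setTI; case: cF => _ + _; apply.
Qed.

Let rho0 : rho set0 = 0.
Proof.
have F0 : F set0 by apply/FS; exact: measurable0.
have := rho_additive F0 F0 (setI0 _); rewrite setU0 => /eqP.
by rewrite -subr_eq0 opprD addrA subrr sub0r oppr_eq0 => /eqP.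
Qed.

Let nu (H : set TF) : \bar R := (rho H)%:E.

Let rho_bigsetU (G : nat -> set T) n : (forall n, F (G n)) -> trivIset setT G ->
  F (\big[setU/set0]_(i < n) G i) /\
  rho (\big[setU/set0]_(i < n) G i) = \sum_(i < n) rho (G i).
Proof.
move=> FG tG; elim: n => [|n [IHF IH]].
  by rewrite !big_ord0; split => //; apply/FS; exact: measurable0.
rewrite !big_ord_recr/=; split.
  by apply/FS; apply: measurableU; exact/FS.
rewrite rho_additive ?IH//.
rewrite setIC big_distrr/= big1// => i _.
move/trivIsetP : tG => /(_ n i I I) ->//.
by rewrite neq_ltn ltn_ord orbT.
Qed.

(** The tails [H_ n] of a disjoint union decrease to the empty set, so continuity there upgrades
    finite additivity to countable additivity. *)
Let nu_sigma_additive : semi_sigma_additive nu.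
Proof.
move=> G mG tG mUG; have FG n : F (G n) by apply/FS; exact: mG.
have FUG : F (\bigcup_n G n) by exact/FS.
pose H_ n := \bigcup_n G n `\` \big[setU/set0]_(i < n) G i.
have FH n : F (H_ n).
  apply/FS; apply: measurableD => //; apply/FS.
  by have [] := rho_bigsetU n FG tG.
have Hdec n : H_ n.+1 `<=` H_ n.
  by move=> t; rewrite /H_ big_ord_recr/= => -[? /not_orP[? _]]; split.
have H0 : \bigcap_n H_ n = set0.
  rewrite -subset0 => t /= Ht; have [[n _ Gnt] _] := Ht 0 I.
  have [_] := Ht n.+1 I; apply; rewrite big_ord_recr/=; by right.
have rhoE n : \sum_(0 <= i < n) nu (G i) = (rho (\bigcup_n G n) - rho (H_ n))%:E.
  rewrite big_mkord sumEFin; congr EFin.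
  have [FB <-] := rho_bigsetU n FG tG.
  have UE : \bigcup_n G n = \big[setU/set0]_(i < n) G i `|` H_ n.
    apply/seteqP; split=> [t Gt|t [|[]//]].
      by have [|] := pselect ((\big[setU/set0]_(i < n) G i) t); [left|right; split].
    by rewrite -bigcup_mkord => -[k _ ?]; exists k.
  by rewrite [in X in _ = X - _]UE rho_additive ?addrK// /H_ setDE setICA setICr setI0.
rewrite (_ : (fun n => _) = EFin \o (fun n => rho (\bigcup_n G n) - rho (H_ n))).
  apply: cvg_EFin; first exact: nearW.
  rewrite -[X in _ --> X]subr0; apply: cvgB; first exact: cvg_cst.
  exact: rho_continuous.
by apply/funext => n; exact: rhoE.
Qed.

(** Since [rho] may change sign, it is treated as a charge on [F]; its density with respect to the
    restriction of [P] to [F] is measurable for [F] by construction. *)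
Lemma subalgebra_Radon_Nikodym : exists W : T -> R,
  [/\ mf F W, L1 P W & forall H, F H -> Ev P (\1_H \* W) = rho H].
Proof.
pose nuC : {charge set TF -> \bar R} := HB.pack nu
  (isCharge.Build _ _ _ nu (congr1 EFin rho0) (fun _ _ => isT) nu_sigma_additive).
(* The restriction of [P] to [F] is realized as the law of the identity map into [T] equipped with
   [F]. *)
pose phi : {mfun T >-> TF} := HB.pack idF (isMeasurableFun.Build _ _ _ _ idF mid).
pose Q := distribution P phi.
have nuQ : nuC `<< Q.
  apply/null_content_dominatesP => H mH QH; congr EFin; apply: rho_null => //.
  exact/FS.
have [W [Wfin iW WE]] :
    exists W : TF -> \bar R, [/\ forall t, W t \is a fin_num,
      Q.-integrable [set: TF] W &
      forall H, measurable H -> nu H = (\int[Q]_(t in H) W t)%E].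
  exists (Radon_Nikodym nuC Q); split.
  - by move=> t; exact: Radon_Nikodym_fin_num.
  - exact: Radon_Nikodym_integrable.
  - by move=> H mH; rewrite -Radon_Nikodym_integral.
have mW := measurable_int _ iW.
have WP : EFin \o (fine \o W) = W by apply/funext => t /=; rewrite fineK.
have iWP : P.-integrable [set: T] (W : T -> \bar R).
  apply/integrableP; split.
    exact: (measurableT_comp mW mid).
  move/integrableP : iW => [_].
  rewrite ge0_integral_distribution//.
  by apply: measurableT_comp.
exists (fine \o W); split.
- by apply/measurable_EFinP; rewrite WP.
- by rewrite /L1 WP.
move=> H FH; have /WE : measurable (H : set TF) by exact/FS.
rewrite /nu /Ev /Rintegral => /(congr1 fine)/= ->; congr fine.
have mH : d.-measurable H by case: cF => _ + _; exact.
rewrite integral_pushforward//; last 2 first.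
- exact: integrableS iWP.
- exact/FS.
rewrite integral_mkcond; apply: eq_integral => t _.
by rewrite patchE indicE; case: ifPn => _; rewrite ?mul1r ?mul0r//= fineK.
Qed.

End RadonNikodym.

(** * Disintegration of a positive functional along a sub-sigma-algebra *)

Section ConditionalOperator.
Context {d : measure_display} {T : measurableType d} {R : realType}.
Variables (P : probability T R) (F : set (set T)) (p : \bar R).
Hypotheses (cF : complete_subalgebra P F)
  (cB : complete_subalgebra P d.-measurable) (p1 : (1 <= p)%E).

Local Notation LB := (Lp P d.-measurable p).
Local Notation LBp := (Lp_nneg P d.-measurable p).

Variable v : (T -> R) -> R.
Hypothesis vL : forall a X Y, LB X -> LB Y -> v (a \*: X \+ Y) = a * v X + v Y.
Hypothesis v_ge0 : forall X, LBp X -> 0 <= v X.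
Hypothesis v_cont : forall X (H_ : nat -> set T), LBp X -> (forall n, F (H_ n)) ->
  (forall n, H_ n.+1 `<=` H_ n) -> \bigcap_n H_ n = set0 ->
  v (\1_(H_ n) \* X) @[n --> \oo] --> 0.

Let FB (H : set T) : F H -> d.-measurable H.
Proof. by case: cF => _ + _; exact. Qed.

Lemma positive_functional_le X Y : LB X -> LB Y -> ae_le P X Y -> v X <= v Y.
Proof.
move=> lX lY XY; have /v_ge0 : LBp ((-1) \*: X \+ Y).
  split; first exact: LpL.
  by move: XY; apply: filterS => t /=; rewrite scaleN1r addrC subr_ge0.
by rewrite vL// mulN1r addrC subr_ge0.
Qed.

(** [v] acts on functions and not on classes; positivity, tested on functions that are nonnegative
    only a.e., makes it blind to null sets. *)
Lemma positive_functional_ae X Y : LB X -> LB Y -> (\forall t \ae P, X t = Y t) ->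
  v X = v Y.
Proof.
move=> lX lY XY; apply/eqP; rewrite eq_le !positive_functional_le//.
  by move: XY; apply: filterS => t ->.
by move: XY; apply: filterS => t ->.
Qed.

(** When [v] is the expectation, these [W] are the versions of the conditional expectation of [X]
    given [F]. *)
Definition conditional_value X (W : T -> R) :=
  [/\ mf F W, L1 P W & forall H, F H -> Ev P (\1_H \* W) = v (\1_H \* X)].

Definition conditional_operator X : T -> R :=
  xget (cst 0) [set W | conditional_value X W].

Local Notation C := conditional_operator.

Lemma conditional_operatorP X : LB X -> conditional_value X (C X).
Proof.
move=> lX; suff [W WX] : exists W, conditional_value X W.
  by rewrite /C; case: xgetP => [? -> //|/(_ W)].
have lH (H : set T) : F H -> LB (\1_H \* X).
  by move=> FH; apply: Lp_indicM => //; exact: FB.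
have lXp := Lp_funrpos p1 cB lX; have lXn := Lp_funrneg p1 cB lX.
apply: subalgebra_Radon_Nikodym => //.
- move=> H K FH FK HK0; have := vL 1 (lH _ FH) (lH _ FK); rewrite mul1r => <-.
  congr v; apply/funext => t /=; rewrite scale1r -mulrDl; congr (_ * _).
  rewrite !indicE in_setU.
  have [tH|] := boolP (t \in H); have [tK|] := boolP (t \in K);
    rewrite ?addr0 ?add0r//=.
  by have : t \in H `&` K by [rewrite inE; split; apply: set_mem];
     rewrite HK0 in_set0.
- move=> H_ FH Hdec H0.
  (* Continuity along decreasing sets is assumed for nonnegative functions only, whence the
     splitting. *)
  have E n : v (\1_(H_ n) \* X) = v (\1_(H_ n) \* X^\+) - v (\1_(H_ n) \* X^\-).
    have := vL (-1) (proj1 (Lp_nneg_indicM p1 cB (FB (FH n)) lXn))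
                    (proj1 (Lp_nneg_indicM p1 cB (FB (FH n)) lXp)).
    rewrite mulN1r [- _ + _]addrC => <-; congr v; apply/funext => t /=.
    rewrite scaleN1r addrC -mulrBr; congr (_ * _).
    by rewrite -[in LHS](funrposBneg X).
  under eq_fun do rewrite E.
  have := cvgB (v_cont lXp FH Hdec H0) (v_cont lXn FH Hdec H0); rewrite subr0.
  by apply; exact: eventually_filter.
move=> H FH PH; have -> : v (\1_H \* X) = v (0 \*: X \+ cst 0).
  apply: positive_functional_ae; [exact: lH|by apply: LpL => //; exact: Lp_cst|].
  exists H; split => //; first exact: FB.
  move=> t /=; rewrite scale0r addr0 indicE; case: (boolP (t \in H)).
    by rewrite inE.
  by rewrite mul0r.
rewrite vL ?mul0r ?add0r//; last exact: Lp_cst.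
have := vL (-1) (Lp_cst p1 0 cB) (Lp_cst p1 0 cB); rewrite (_ : _ \+ _ = cst 0).
  by lra.
by apply/funext => t /=; rewrite scaler0 addr0.
Qed.

Lemma conditional_mf X : LB X -> mf F (C X).
Proof. by move=> /conditional_operatorP[]. Qed.

Lemma conditional_L1 X : LB X -> L1 P (C X).
Proof. by move=> /conditional_operatorP[]. Qed.

Lemma conditional_Ev X H : LB X -> F H -> Ev P (\1_H \* C X) = v (\1_H \* X).
Proof. by move=> /conditional_operatorP[_ _ +] => /[apply]. Qed.

Lemma Ev_conditional X : LB X -> Ev P (C X) = v X.
Proof.
have E (Y : T -> R) : \1_[set: T] \* Y = Y.
  by apply/funext => t /=; rewrite indicT mul1r.
by move=> lX; have := conditional_Ev lX (subalgebraT cF); rewrite !E.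
Qed.

Lemma conditional_upper_bound X Z : LB X -> mf F Z -> L1 P Z ->
  (forall H, F H -> v (\1_H \* X) <= Ev P (\1_H \* Z)) -> ae_le P (C X) Z.
Proof.
move=> lX mZ iZ XZ; apply: (ae_le_of_Ev cF) => //.
- exact: conditional_mf.
- exact: conditional_L1.
by move=> H FH; rewrite conditional_Ev//; exact: XZ.
Qed.

Lemma conditional_lower_bound X Z : LB X -> mf F Z -> L1 P Z ->
  (forall H, F H -> Ev P (\1_H \* Z) <= v (\1_H \* X)) -> ae_le P Z (C X).
Proof.
move=> lX mZ iZ XZ; apply: (ae_le_of_Ev cF) => //.
- exact: conditional_mf.
- exact: conditional_L1.
by move=> H FH; rewrite conditional_Ev//; exact: XZ.
Qed.

(** Multiplying by the indicator of [H] replaces the test sets [K] by [K] intersected with [H],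
    which are again in [F]. *)
Lemma conditional_local X Y H : LB X -> LB Y -> F H ->
  ae_le P (\1_H \* X) (\1_H \* Y) -> ae_le P (\1_H \* C X) (\1_H \* C Y).
Proof.
move=> lX lY FH XY; have mH := FB FH.
have KH K (Z : T -> R) : \1_K \* (\1_H \* Z) = \1_(K `&` H) \* Z.
  by apply/funext => t /=; rewrite indicI/= mulrA.
apply: (ae_le_of_Ev cF).
- apply: (@measurable_funM _ (g_sigma_algebraType F)); last exact: conditional_mf.
  by have := subalgebra_indic cF FH; exact.
- apply: (@measurable_funM _ (g_sigma_algebraType F)); last exact: conditional_mf.
  by have := subalgebra_indic cF FH; exact.
- by apply: L1_indic => //; exact: conditional_L1.
- by apply: L1_indic => //; exact: conditional_L1.
move=> K FK; have FKH := subalgebraI cF FK FH.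
rewrite !KH !conditional_Ev// -!KH; apply: positive_functional_le.
- by rewrite KH; apply: Lp_indicM => //; exact: FB.
- by rewrite KH; apply: Lp_indicM => //; exact: FB.
by move: XY; apply: filterS => t /= XY; apply: ler_wpM2l.
Qed.

Lemma conditional_le X Y : LB X -> LB Y -> ae_le P X Y -> ae_le P (C X) (C Y).
Proof.
move=> lX lY XY; apply: (ae_le_of_Ev cF); do ?[exact: conditional_mf|exact: conditional_L1].
move=> H FH; rewrite !conditional_Ev//; apply: positive_functional_le.
- by apply: Lp_indicM => //; exact: FB.
- by apply: Lp_indicM => //; exact: FB.
by move: XY; apply: filterS => t /= XY; rewrite ler_wpM2l// indicE.
Qed.

Lemma conditional_eq X Y : LB X -> LB Y -> (\forall t \ae P, X t = Y t) ->
  \forall t \ae P, C X t = C Y t.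
Proof.
move=> lX lY XY.
have : ae_le P (C X) (C Y).
  by apply: conditional_le => //; move: XY; apply: filterS => t ->.
have : ae_le P (C Y) (C X).
  by apply: conditional_le => //; move: XY; apply: filterS => t ->.
by apply: filterS2 => t ? ?; apply/eqP; rewrite eq_le; apply/andP.
Qed.

Lemma conditional_linear a X Y : LB X -> LB Y ->
  \forall t \ae P, C (a \*: X \+ Y) t = a * C X t + C Y t.
Proof.
move=> lX lY; have lXY := LpL p1 a lX lY.
have mXY : mf F (a \*: C X \+ C Y).
  apply: (@measurable_funD _ (g_sigma_algebraType F)); last exact: conditional_mf.
  by apply: measurable_funM => //; exact: conditional_mf.
have iX := conditional_L1 lX; have iY := conditional_L1 lY.
have iXY : L1 P (a \*: C X \+ C Y) by exact: L1L.
have E H : F H -> v (\1_H \* (a \*: X \+ Y)) = Ev P (\1_H \* (a \*: C X \+ C Y)).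
  move=> FH; have mH := FB FH.
  have D (U V : T -> R) : \1_H \* (a \*: U \+ V) = a \*: (\1_H \* U) \+ (\1_H \* V).
    by apply/funext => t /=; rewrite mulrDr; congr (_ + _); rewrite mulrCA.
  rewrite !D vL; try exact: Lp_indicM.
  rewrite EvL; try exact: L1_indic.
  by rewrite !conditional_Ev.
have : ae_le P (C (a \*: X \+ Y)) (a \*: C X \+ C Y).
  by apply: conditional_upper_bound => // H FH; rewrite E.
have : ae_le P (a \*: C X \+ C Y) (C (a \*: X \+ Y)).
  by apply: conditional_lower_bound => // H FH; rewrite E.
by apply: filterS2 => t ? ?; apply/eqP; rewrite eq_le; apply/andP.
Qed.

Lemma conditional_ge0 X : LBp X -> ae_le P (cst 0) (C X).
Proof.
move=> [lX X0]; apply: conditional_lower_bound => //; first exact: L1_cst.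
move=> H FH; have -> : Ev P (\1_H \* cst 0) = 0.
  rewrite (_ : _ \* _ = cst 0); last by apply/funext => t /=; rewrite mulr0.
  by rewrite /Ev Rintegral_cst// mul0r.
by apply: v_ge0; apply: Lp_nneg_indicM => //; exact: FB.
Qed.

(** On the set where [r n < xi], locality turns [r n * X <= xi * X] into the same inequality between
    conditional values, and likewise from above. The rational levels being countable, both hold a.e.
    at all of them, and density concludes. *)
Let hom_nneg (X xi : T -> R) : LBp X -> mf F xi -> LB (xi \* X) ->
  \forall t \ae P, C (xi \* X) t = xi t * C X t.
Proof.
move=> [lX X0] mxi lxiX.
pose r (n : nat) : R := ratr (odflt 0 (unpickle n)).
have rE (x y : R) : x < y -> exists2 n, x < r n & r n < y.
  move=> /rat_in_itvoo[q]; rewrite in_itv/= => /andP[xq qy].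
  by exists (pickle q); rewrite /r pickleK.
have mr n : mf F (cst (r n) : T -> R) by exact: measurable_cst.
have lrX n : LB (r n \*: X) by exact: LpZ.
have Cr n : \forall t \ae P, C (r n \*: X) t = r n * C X t.
  have := conditional_linear (r n) lX (LpZ p1 0 cB lX).
  have : \forall t \ae P, C (0 \*: X) t = 0.
    have := conditional_linear (-1) (LpZ p1 0 cB lX) (LpZ p1 0 cB lX).
    rewrite (_ : _ \+ _ = 0 \*: X).
      by apply: filterS => t; rewrite mulN1r addNr.
    by apply/funext => t /=; rewrite !scale0r scaler0 addr0.
  rewrite (_ : r n \*: X \+ _ = r n \*: X).
    by apply: filterS2 => t -> ->; rewrite addr0.
  by apply/funext => t /=; rewrite scale0r addr0.
have low n : \forall t \ae P, r n < xi t -> r n * C X t <= C (xi \* X) t.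
  have FH := subalgebra_lt cF (mr n) mxi; set H := [set t | _] in FH.
  have := conditional_local (lrX n) lxiX FH.
  have : ae_le P (\1_H \* (r n \*: X)) (\1_H \* (xi \* X)).
    move: X0; apply: filterS => t /= X0; rewrite indicE.
    have [|_] := boolP (t \in H); last by rewrite !mul0r.
    by rewrite inE /H/= !mul1r => /ltW ?; exact: ler_wpM2r.
  move=> /[swap] /[apply]; move: (Cr n); apply: filterS2 => t /= -> + rxi.
  by rewrite indicE mem_set// !mul1r.
have up n : \forall t \ae P, xi t < r n -> C (xi \* X) t <= r n * C X t.
  have FH := subalgebra_lt cF mxi (mr n); set H := [set t | _] in FH.
  have := conditional_local lxiX (lrX n) FH.
  have : ae_le P (\1_H \* (xi \* X)) (\1_H \* (r n \*: X)).
    move: X0; apply: filterS => t /= X0; rewrite indicE.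
    have [|_] := boolP (t \in H); last by rewrite !mul0r.
    by rewrite inE /H/= !mul1r => /ltW ?; exact: ler_wpM2r.
  move=> /[swap] /[apply]; move: (Cr n); apply: filterS2 => t /= -> + rxi.
  by rewrite indicE mem_set// !mul1r.
have C0 := conditional_ge0 (conj lX X0).
apply: filterS3 C0 (ae_foralln low) (ae_foralln up) => t /= C0 lo hi.
(* [C X t] may vanish; the rational is taken within [e / (C X t + 1)] of [xi t], so that
   multiplication by [C X t] costs at most [e]. *)
have C1 : 0 < C X t + 1 by lra.
apply/eqP; rewrite eq_le; apply/andP; split; apply/ler_addgt0Pr => e e0.
  have [n xn nx] : exists2 n, xi t < r n & r n < xi t + e / (C X t + 1).
    by apply: rE; rewrite ltrDl divr_gt0.
  apply: (le_trans (hi n xn)).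
  apply: (@le_trans _ _ ((xi t + e / (C X t + 1)) * C X t)).
    by apply: ler_wpM2r => //; exact: ltW.
  by rewrite mulrDl lerD2l mulrAC ler_pdivrMr// ler_wpM2l ?ltW//; lra.
have [n xn nx] : exists2 n, xi t - e / (C X t + 1) < r n & r n < xi t.
  by apply: rE; rewrite ltrBlDr ltrDl divr_gt0.
rewrite -lerBlDr; apply: le_trans (lo n nx).
apply: (@le_trans _ _ ((xi t - e / (C X t + 1)) * C X t)).
  by rewrite mulrBl lerD2l lerN2 mulrAC ler_pdivrMr// ler_wpM2l ?ltW//; lra.
by apply: ler_wpM2r => //; exact: ltW.
Qed.

(** Only [X] is split into its positive and negative parts: their products with [xi] are dominated
    by [xi \* X], hence remain in L_p. *)
Lemma conditional_homogeneous (X xi : T -> R) : LB X -> mf F xi -> LB (xi \* X) ->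
  \forall t \ae P, C (xi \* X) t = xi t * C X t.
Proof.
move=> lX mxi lxiX.
have lXp := Lp_funrpos p1 cB lX; have lXn := Lp_funrneg p1 cB lX.
have mxiT := subalgebra_mf_all (subalgebra_measurable_fun cF mxi).
have lxi (Y : T -> R) : LB Y -> (forall t, `|Y t| <= `|X t|) -> LB (xi \* Y).
  move=> lY YX; apply: (Lp_dominated p1 cB lxiX).
    by apply: measurable_funM => //; exact: Lp_mf lY.
  by apply: aeW => t /=; rewrite !normrM ler_wpM2l.
have lxip : LB (xi \* X^\+).
  apply: lxi; first by case: lXp.
  move=> t; rewrite ger0_norm ?funrpos_ge0// /funrpos.
  by rewrite ge_max ler_norm normr_ge0.
have lxin : LB (xi \* X^\-).
  apply: lxi; first by case: lXn.
  move=> t; rewrite ger0_norm ?funrneg_ge0// /funrneg.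
  by rewrite ge_max -normrN ler_norm normr_ge0.
have Xpn : (-1) \*: X^\- \+ X^\+ = X.
  by apply/funext => t /=; rewrite scaleN1r addrC -[in RHS](funrposBneg X).
have xiXpn : (-1) \*: (xi \* X^\-) \+ (xi \* X^\+) = xi \* X.
  by rewrite -[in RHS]Xpn; apply/funext => t /=; rewrite mulrDr !scaleN1r mulrN.
have := conditional_linear (-1) (proj1 lXn) (proj1 lXp); rewrite Xpn => CX.
have := conditional_linear (-1) lxin lxip; rewrite xiXpn => CxiX.
have homp := hom_nneg lXp mxi lxip; have homn := hom_nneg lXn mxi lxin.
have {}homp : \forall t \ae P, C (xi \* X) t = - C (xi \* X^\-) t + xi t * C X^\+ t.
  by apply: filterS2 homp CxiX => t <- ->; rewrite mulN1r.
by apply: filterS3 homn homp CX => t /= -> -> ->; ring.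
Qed.

End ConditionalOperator.

(** * Essential suprema *)

Section EssentialSupremum.
Context {d : measure_display} {T : measurableType d} {R : realType}.
Variable P : probability T R.

Let combine U (s : nat -> nat -> U) k :=
  if @unpickle (nat * nat)%type k is Some (i, j) then s i j else s 0%N 0%N.

Let combineE U (s : nat -> nat -> U) i j : exists k, combine s k = s i j.
Proof. by exists (pickle (i, j)); rewrite /combine pickleK. Qed.

Let combine_in U (A : set U) (s : nat -> nat -> U) : (forall i j, A (s i j)) ->
  forall k, A (combine s k).
Proof. by move=> As k; rewrite /combine; case: unpickle => // -[]. Qed.

(** Merging countably many almost optimal sequences gives a countable union of maximal probability;
    adjoining one more member [V] cannot enlarge it by a set of positive probability. *)
Lemma countable_exhaustion (G : set (set T)) : G !=set0 -> G `<=` d.-measurable ->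
  exists U_ : nat -> set T, (forall n, G (U_ n)) /\
    forall V, G V -> P (V `\` \bigcup_n U_ n) = 0%E.
Proof.
move=> [U0 GU0] mG.
pose E := [set fine (P (\bigcup_n s n)) | s in [set s : nat -> set T | forall n, G (s n)]].
have mU (s : nat -> set T) : (forall n, G (s n)) -> measurable (\bigcup_n s n).
  by move=> Gs; apply: bigcup_measurable => n _; exact: mG.
have supE : has_sup E.
  split; first by exists (fine (P (\bigcup_(n in [set: nat]) U0))), (fun=> U0).
  exists 1 => _ [s Gs <-]; rewrite -lee_fin fineK ?fin_num_measure//; last exact: mU.
  by apply: probability_le1; exact: mU.
have adh n : exists s : nat -> set T, (forall k, G (s k)) /\
    sup E - n.+1%:R^-1 < fine (P (\bigcup_k s k)).
  have n0 : 0 < n.+1%:R^-1 :> R by rewrite invr_gt0.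
  by have [_ [s Gs <-] lt] := sup_adherent n0 supE; exists s.
have [s sP] := choice adh.
have Gs : forall k, G (combine s k) by apply: combine_in => i j; exact: (sP i).1.
exists (combine s); split => // V GV.
have mV := mG _ GV; have mC := mU _ Gs; set C := \bigcup_n _ in mC *.
have supC : sup E <= fine (P C).
  apply/ler_addgt0Pr => e e0.
  have [n ne] : exists n : nat, n.+1%:R^-1 < e.
    by have [n] := ltr_add_invr e0; rewrite add0r => ne; exists n.
  have sC : \bigcup_k s n k `<=` C.
    by move=> t [k _ st]; have [l sl] := combineE s n k; exists l => //; rewrite sl.
  have : fine (P (\bigcup_k s n k)) <= fine (P C).
    apply: fine_le; rewrite ?fin_num_measure//; try exact: mU (sP n).1.
    by apply: le_measure; rewrite ?inE//; exact: mU (sP n).1.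
  rewrite -lerBlDr; apply: le_trans; apply/ltW; apply: le_lt_trans (sP n).2.
  by rewrite lerD2l lerN2 ltW.
have mD : measurable (V `\` C) by exact: measurableD.
have : fine (P (C `|` (V `\` C))) <= sup E.
  apply: ub_le_sup; first by case: supE.
  (* [V] is placed in front of the optimal sequence, so that the enlarged union still competes in
     the supremum. *)
  exists (fun n => if n is n'.+1 then combine s n' else V).
    by case=> [//|n]; exact: Gs.
  congr (fine (P _)); apply/seteqP; split=> [t [[|n] _ st]|t [[n _ st]|[Vt _]]].
  - by have [|] := pselect (C t); [left|right].
  - by left; exists n.
  - by exists n.+1.
  - by exists 0%N.
rewrite measureU//; last by rewrite setDE setICA setICr setI0.
rewrite fineD ?fin_num_measure// => le0.
have : fine (P (V `\` C)) = 0.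
  by apply/eqP; rewrite eq_le fine_ge0// andbT; lra.
by move=> P0; rewrite -[LHS]fineK ?fin_num_measure// P0.
Qed.

Let lte_rat (x y : \bar R) : (x < y)%E ->
  exists n : nat, (x < (ratr (odflt 0 (unpickle n)))%:E < y)%E.
Proof.
have rE (a b : R) : a < b -> exists n, a < ratr (odflt 0 (unpickle n)) < b.
  move=> /rat_in_itvoo[q]; rewrite in_itv/= => qab.
  by exists (pickle q); rewrite pickleK.
case: x y => [x| |] [y| |]//=.
- by rewrite lte_fin => /rE[n]; exists n; rewrite !lte_fin.
- have /rE[n /andP[xn _]] : x < x + 1 by rewrite ltrDl.
  by exists n; rewrite lte_fin xn ltry.
- have /rE[n /andP[_ xn]] : y - 1 < y by rewrite ltrBlDr ltrDl.
  by exists n; rewrite lte_fin xn ltNyr.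
- by exists 0%N; rewrite ltry ltNyr.
Qed.

Definition pointwise_sup (h : nat -> T -> \bar R) t := ereal_sup (range (h ^~ t)).

Lemma pointwise_sup_ge h n t : (h n t <= pointwise_sup h t)%E.
Proof. by apply: ereal_sup_ubound; exists n. Qed.

Lemma pointwise_sup_le h t x : (forall n, (h n t <= x)%E) -> (pointwise_sup h t <= x)%E.
Proof. by move=> hx; apply: ge_ereal_sup => _ [n _ <-]. Qed.

Lemma mf_pointwise_sup d' (T' : measurableType d') (h : nat -> T' -> \bar R) :
  (forall n, measurable_fun [set: T'] (h n)) ->
  measurable_fun [set: T'] (fun t => ereal_sup (range (h ^~ t))).
Proof.
move=> mh; have := measurable_fun_esups mh 0.
congr measurable_fun; apply/funext => t; rewrite /esups/=; congr ereal_sup.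
by apply/seteqP; split=> [_ [n _ <-]|_ [n _ <-]]; exists n.
Qed.

Variable F : set (set T).
Hypothesis cF : complete_subalgebra P F.

(** For each rational level the sets [lev n h] are exhausted by countably many members of [S]. A
    member exceeding the resulting countable supremum would be separated from it by a rational
    level, on a null set only. Working with level sets requires no integrability. *)
Lemma countable_esssup (S : set (T -> \bar R)) : S !=set0 ->
  (forall h, S h -> mf F h) ->
  exists h_ : nat -> T -> \bar R, (forall n, S (h_ n)) /\
    is_esssup P S (pointwise_sup h_).
Proof.
move=> [h0 Sh0] mS.
have mSB h : S h -> measurable_fun [set: T] h.
  by move=> Sh; have := subalgebra_measurable_fun cF (mS _ Sh); exact.
pose r n : \bar R := (ratr (odflt 0 (@unpickle rat n)))%:E.
pose lev n (h : T -> \bar R) := [set t | (r n < h t)%E].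
have mlev n h : S h -> measurable (lev n h).
  move=> /mSB mh; rewrite -[X in measurable X]setTI.
  exact: emeasurable_fun_o_infty.
have ex n : exists g : nat -> T -> \bar R, (forall k, S (g k)) /\
    forall h, S h -> P (lev n h `\` \bigcup_k lev n (g k)) = 0%E.
  have [||U [GU PU]] := @countable_exhaustion [set lev n h | h in S].
  - by exists (lev n h0), h0.
  - by move=> _ [h Sh <-]; exact: mlev.
  have /choice[g gP] k : exists h, S h /\ lev n h = U k.
    by have [h Sh hU] := GU k; exists h.
  exists g; split=> [k|h Sh]; first by have [] := gP k.
  rewrite [X in _ `\` X](_ : _ = \bigcup_k U k); first by apply: PU; exists h.
  by apply: eq_bigcup => // k _; have [] := gP k.
have [g gP] := choice ex.
have Sg : forall k, S (combine g k) by apply: combine_in => i j; exact: (gP i).1.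
have mg k := mSB _ (Sg k).
exists (combine g); split => //; split.
- by apply: mf_pointwise_sup => k; exact: mg.
- move=> h Sh.
  have N n : P.-negligible (lev n h `\` \bigcup_k lev n (g n k)).
    apply/negligibleP; last exact: (gP n).2.
    apply: measurableD; first exact: mlev.
    by apply: bigcup_measurable => k _; apply: mlev; exact: (gP n).1.
  apply: negligibleS (negligible_bigcup N) => t /= /negP; rewrite -ltNge.
  move=> /lte_rat[n /andP[lo hi]]; exists n => //; split => //.
  move=> [k _] /=; apply/negP; rewrite -leNgt; apply: le_trans (ltW lo).
  by have [l <-] := combineE g n k; exact: pointwise_sup_ge.
move=> f mf fS; have := ae_foralln (fun n => fS _ (Sg n)).
by apply: filterS => t ft; exact: pointwise_sup_le.
Qed.

Lemma is_esssup_ae_eq (S : set (T -> \bar R)) f g :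
  is_esssup P S f -> is_esssup P S g -> \forall t \ae P, f t = g t.
Proof.
move=> [mf fS fle] [mg gS gle].
apply: filterS2 (fle _ mg gS) (gle _ mf fS) => t fg gf.
by apply/eqP; rewrite eq_le fg gf.
Qed.

Lemma esssupP (S : set (T -> \bar R)) : S !=set0 -> (forall h, S h -> mf F h) ->
  is_esssup P S (esssup P S).
Proof.
move=> S0 mS; have [h [_ hS]] := countable_esssup S0 mS.
by rewrite /esssup; case: xgetP => [f -> //|/(_ _ hS)].
Qed.

(** The chosen version of the essential supremum is only known to be measurable for the ambient
    sigma-algebra; it equals a.e. a countable supremum of members of [S], and [F] contains the null
    sets. *)
Lemma mf_esssup (S : set (T -> \bar R)) : S !=set0 -> (forall h, S h -> mf F h) ->
  mf F (esssup P S).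
Proof.
move=> S0 mS; have [h [Sh hS]] := countable_esssup S0 mS.
apply: (ae_eq_subalgebra cF (is_esssup_ae_eq hS (esssupP S0 mS))).
by apply: (@mf_pointwise_sup _ (g_sigma_algebraType F)) => n; exact: mS.
Qed.

End EssentialSupremum.

(** * Continuity of positive operators *)

Section PositiveOperator.
Context {d : measure_display} {T : measurableType d} {R : realType}.
Variables (P : probability T R) (A : set (set T)) (p : \bar R).
Hypotheses (cA : complete_subalgebra P A)
  (cB : complete_subalgebra P d.-measurable) (p1 : (1 <= p)%E).

Local Notation LB := (Lp P d.-measurable p).
Local Notation LA := (Lp P A p).
Local Notation LBp := (Lp_nneg P d.-measurable p).

Variable V : (T -> R) -> T -> R.
Hypotheses (V_op : is_operator P LB LA V) (V_lin : linear_operator P p V)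
  (V_nneg : nonnegative_operator P p V).

Lemma linear_operatorE a X Y : LB X -> LB Y ->
  \forall t \ae P, V (a \*: X \+ Y) t = a * V X t + V Y t.
Proof.
by move=> lX lY; have := V_lin a lX lY; apply: filterS => t /(_ I).
Qed.

Lemma linear_operator0 : \forall t \ae P, V (cst 0) t = 0.
Proof.
have := linear_operatorE (-1) (Lp_cst p1 0 cB) (Lp_cst p1 0 cB).
rewrite (_ : _ \+ _ = cst 0); first by apply: filterS => t; lra.
by apply/funext => t /=; rewrite scaler0 addr0.
Qed.

Lemma linear_operatorZ a X : LB X -> \forall t \ae P, V (a \*: X) t = a * V X t.
Proof.
move=> lX; apply: filterS2 linear_operator0 (linear_operatorE a lX (Lp_cst p1 0 cB)).
move=> t V0; rewrite (_ : _ \+ _ = a \*: X) ?V0 ?addr0//.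
by apply/funext => s /=; rewrite addr0.
Qed.

Lemma linear_operatorD X Y : LB X -> LB Y ->
  \forall t \ae P, V (X \+ Y) t = V X t + V Y t.
Proof.
move=> lX lY; apply: filterS (linear_operatorE 1 lX lY) => t; rewrite mul1r => <-.
by congr (V _ _); apply/funext => s /=; rewrite scale1r.
Qed.

Lemma linear_operatorB X Y : LB X -> LB Y ->
  \forall t \ae P, V (X \- Y) t = V X t - V Y t.
Proof.
move=> lX lY; apply: filterS (linear_operatorE (-1) lY lX) => t.
rewrite mulN1r addrC => <-.
by congr (V _ _); apply/funext => s /=; rewrite scaleN1r addrC.
Qed.

Lemma positive_operator_le X Y : LB X -> LB Y -> ae_le P X Y -> ae_le P (V X) (V Y).
Proof.
move=> lX lY XY; have /V_nneg : LBp (Y \- X).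
  split; first exact: LpB.
  by move: XY; apply: filterS => t /=; rewrite subr_ge0.
by apply: filterS2 (linear_operatorB lY lX) => t -> /=; rewrite subr_ge0.
Qed.

Lemma positive_operator_norm X Y : LB X -> LB Y ->
  (\forall t \ae P, `|X t| <= Y t) -> \forall t \ae P, `|V X t| <= V Y t.
Proof.
move=> lX lY XY.
have up : ae_le P (V X) (V Y).
  apply: positive_operator_le => //; apply: filterS XY => t.
  by apply: le_trans; exact: ler_norm.
have lo : ae_le P (V ((-1) \*: X)) (V Y).
  apply: positive_operator_le => //; first exact: LpZ.
  apply: filterS XY => t /=; apply: le_trans.
  by rewrite scaleN1r -normrN; exact: ler_norm.
apply: filterS3 up lo (linear_operatorZ (-1) lX) => t VXY + VNX.
by rewrite VNX mulN1r ler_norml lerNl => ->.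
Qed.

(* [h = \sum_k (k+1)^r |D_k|^r] is integrable, so [h^(1/r)] is in [L_r] and
   dominates every [(k+1) |D_k|]. *)
Lemma Lp_fast_dominated r (D : nat -> T -> R) : p = r%:E -> (forall k, LB (D k)) ->
  (forall k, ('N[P]_p[EFin \o D k] <
    (((k.+1%:R `^ r)^-1 * (1 / (2 ^ k)%:R)) `^ r^-1)%:E)%E) ->
  exists2 G, LB G & forall k, \forall t \ae P, k.+1%:R * `|D k t| <= G t.
Proof.
move=> pr lD DN; have r1 : 1 <= r by rewrite -lee_fin -pr.
have r0 : 0 < r by rewrite (lt_le_trans _ r1).
have rN0 : r != 0 by rewrite gt_eqF.
pose f k t := ((k.+1%:R * `|D k t|) `^ r)%:E.
have mf' k : measurable_fun [set: T] (f k).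
  apply/measurable_EFinP; apply: (@measurableT_comp _ _ _ _ _ _ (@powR R ^~ r)) => //.
  apply: measurable_funM => //; apply: measurableT_comp => //.
  exact: Lp_measurable (lD k).
have f0 k t : (0 <= f k t)%E by rewrite lee_fin powR_ge0.
(* The assumed bound on the norm of [D k] is what makes the [k]-th integral at most [2 ^ - k]. *)
have If k : (\int[P]_t f k t <= (1 / (2 ^ k)%:R)%:E)%E.
  have -> : (\int[P]_t f k t = (k.+1%:R `^ r)%:E * 'N[P]_p[EFin \o D k] `^ r)%E.
    rewrite pr powR_Lnorm// -ge0_integralZl//=.
      by apply: eq_integral => t _; rewrite /f powRM// EFinM.
    apply/measurable_EFinP; apply: (@measurableT_comp _ _ _ _ _ _ (@powR R ^~ r)) => //.
    by apply: measurableT_comp => //; exact: Lp_measurable (lD k).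
  have c0 : 0 < k.+1%:R `^ r :> R by rewrite powR_gt0.
  rewrite -(@lee_pmul2l _ (k.+1%:R `^ r)^-1%:E)//.
  rewrite muleA -EFinM mulVf ?gt_eqF// mul1e -EFinM.
  have -> : ((k.+1%:R `^ r)^-1 * (1 / (2 ^ k)%:R))%:E =
      (((((k.+1%:R `^ r)^-1 * (1 / (2 ^ k)%:R)) `^ r^-1)%:E) `^ r)%E :> \bar R.
    rewrite poweR_EFin -powRrM mulVf// powRr1// mulr_ge0// ?invr_ge0 ?powR_ge0//.
  apply: gt0_ler_poweR; rewrite ?ltW ?DN ?in_itv/= ?leey ?andbT ?Lnorm_ge0//.
pose h t := (\sum_(k <oo) f k t)%E.
have mh : measurable_fun [set: T] h by apply: ge0_emeasurable_sum.
have h0 t : (0 <= h t)%E by apply: nneseries_ge0.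
have Ih : (\int[P]_t h t <= 2%:E)%E.
  rewrite integral_nneseries//; apply: (@le_trans _ _ (\sum_(k <oo) (1 / (2 ^ k)%:R)%:E)%E).
    by apply: lee_nneseries => [k _ _|k _]; [exact: integral_ge0|exact: If].
  apply: lime_le.
    by apply: is_cvg_nneseries => k _ _; rewrite lee_fin divr_ge0.
  apply: nearW => n; rewrite sumEFin lee_fin.
  have -> : \sum_(0 <= k < n) (1 / (2 ^ k)%:R) = 2 - 2 / (2 ^ n)%:R :> R.
    elim: n => [|n IHn]; first by rewrite big_geq// expn0 divr1 subrr.
    rewrite big_nat_recr//= IHn expnS natrM.
    by field; rewrite pnatr_eq0 -lt0n expn_gt0.
  by rewrite gerBl divr_ge0.
have ih : P.-integrable [set: T] h.
  apply/integrableP; split => //; under eq_integral do rewrite gee0_abs//.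
  by apply: le_lt_trans Ih _; rewrite ltry.
have hfin := integrable_ae measurableT ih.
pose G t := (fine (h t)) `^ r^-1.
have mG : measurable_fun [set: T] G.
  apply: (@measurableT_comp _ _ _ _ _ _ (@powR R ^~ r^-1)) => //.
  exact: measurableT_comp.
exists G.
  split; last exact: subalgebra_mf_all.
  apply/in_LfunP; split => //; rewrite pr unlock /Lnorm.
  apply: poweR_lty; rewrite (_ : (\int[P]_x _)%E = (\int[P]_x (fine (h x))%:E)%E).
    rewrite (@ae_eq_integral _ _ _ P _ h)//.
    - by apply: le_lt_trans Ih _; rewrite ltry.
    - by apply/measurable_EFinP; exact: measurableT_comp.
    - by apply: filterS hfin => t /= /(_ I) hf _; rewrite fineK.
  apply: eq_integral => t _ /=; rewrite ger0_norm ?powR_ge0//.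
  by rewrite -powRrM mulVf// powRr1// fine_ge0.
move=> k; apply: filterS hfin => t /(_ I) hf.
have -> : k.+1%:R * `|D k t| = ((k.+1%:R * `|D k t|) `^ r) `^ r^-1.
  by rewrite -powRrM mulfV// powRr1// mulr_ge0.
apply: ge0_ler_powR; rewrite ?nnegrE ?powR_ge0 ?fine_ge0 ?invr_ge0 ?(ltW r0)//.
rewrite -lee_fin fineK// /h.
rewrite (@nneseriesD1 _ (f ^~ t) k)//.
by apply: leeDl; exact: nneseries_ge0.
Qed.

(** Positive operators on L_p are automatically bounded. If continuity failed at [X], there would be
    [Y k] tending to [X] so fast that one [G] of L_p dominates every [(k + 1) |Y k - X|]; positivity
    then bounds [|V (Y k) - V X|] by [V G / (k + 1)], which tends to 0 in norm. *)
Lemma positive_operator_continuous_fin : p != +oo%E -> continuous_operator P A p V.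
Proof.
move=> pN X lX U; rewrite /Lp_nbhs (negPf pN) => -[e e0 eU].
have [r pr] : exists r, p = r%:E.
  by case: p pN p1 => [r _ _|//|//]; exists r.
have r1 : 1 <= r by rewrite -lee_fin -pr.
apply: contrapT => noV.
pose del k : R := ((k.+1%:R `^ r)^-1 * (1 / (2 ^ k)%:R)) `^ r^-1.
have del0 k : 0 < del k.
  by rewrite powR_gt0// mulr_gt0 ?invr_gt0 ?powR_gt0// divr_gt0// ltr0n expn_gt0.
have /choice[Y YP] k : exists Y, [/\ LB Y, ('N[P]_p[EFin \o (Y \- X)%R] < (del k)%:E)%E
    & ~ U (V Y)].
  apply: contrapT => noY; apply: noV; exists (del k) => // Y lY YX.
  by apply: contrapT => UY; apply: noY; exists Y.
have lD k : LB (Y k \- X) by apply: LpB => //; have [] := YP k.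
have [||G lG GD] := @Lp_fast_dominated r (fun k => Y k \- X) pr.
- exact: lD.
- by move=> k; have [] := YP k.
have LAV Z : LB Z -> LA (V Z) by exact: (proj1 V_op).
have VG k : ('N[P]_p[EFin \o (V (Y k) \- V X)%R] <=
    (k.+1%:R^-1)%:E * 'N[P]_p[EFin \o V G])%E.
  have [lY _ _] := YP k.
  have lVG : V G \in Lfun P p by case: (LAV _ lG).
  have := LnormZ (Lfun_Sub p1 lVG) k.+1%:R^-1; rewrite Lfun_valP.
  rewrite ger0_norm// => <-; apply: le_Lnorm_ae => //.
  - by apply: Lp_measurable; apply: (@LpB _ _ _ _ _ p1 A); exact: LAV.
  - by apply: Lp_measurable; apply: (@LpZ _ _ _ _ _ p1 A); [|exact: LAV].
  have lkG : LB (k.+1%:R^-1 \*: G) by exact: LpZ.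
  have := positive_operator_norm (lD k) lkG.
  have : \forall t \ae P, `|(Y k \- X) t| <= (k.+1%:R^-1 \*: G) t.
    apply: filterS (GD k) => t /=.
    move=> kD; rewrite -[_ *: _]/(_ * _) -(ler_pM2l (ltr0Sn R k)).
    by rewrite mulrA mulfV ?pnatr_eq0// mul1r.
  move=> /[swap] /[apply] VD.
  apply: filterS3 VD (linear_operatorB lY lX) (linear_operatorZ k.+1%:R^-1 lG) => t.
  move=> /[swap] -> /[swap] -> /= /le_trans; apply; exact: ler_norm.
have [g gE] : exists g : R, 'N[P]_p[EFin \o V G]%E = g%:E.
  case: (LAV _ lG) => /in_LfunP[_]; have := Lnorm_ge0 P p (EFin \o V G).
  by case: ('N[P]_p[_])%E => [g _ _|//|//]; exists g.
have g0 : 0 <= g by rewrite -lee_fin -gE Lnorm_ge0.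
have [k kg] : exists k : nat, k.+1%:R^-1 < e / (g + 1).
  have /ltr_add_invr[k] : 0 < e / (g + 1) by rewrite divr_gt0// ltr_wpDl.
  by rewrite add0r => ?; exists k.
have [lY _ nU] := YP k; apply: nU; apply: eU; first exact: LAV.
apply: le_lt_trans (VG k) _; rewrite gE -EFinM lte_fin.
rewrite ltr_pdivlMr in kg; last by rewrite ltr_wpDl.
apply: le_lt_trans kg; rewrite ler_wpM2l ?invr_ge0//; lra.
Qed.

End PositiveOperator.

(** * Weak-star continuity of regular positive operators on L_oo *)

Section WeakStarContinuity.
Context {d : measure_display} {T : measurableType d} {R : realType}.
Variables (P : probability T R) (A : set (set T)).
Hypotheses (cA : complete_subalgebra P A)
  (cB : complete_subalgebra P d.-measurable).

Local Notation Loo := (Lp P d.-measurable +oo%E).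
Local Notation LA := (Lp P A +oo%E).
Local Notation Loop := (Lp_nneg P d.-measurable +oo%E).
Let p1 : (1 <= +oo :> \bar R)%E. Proof. exact: leey. Qed.

Lemma Loo_bounded F (X : T -> R) : Lp P F +oo%E X ->
  exists c : R, \forall t \ae P, `|X t| <= c.
Proof.
move=> [/in_LfunP[_]]; rewrite unlock /Lnorm; case: ifPn => [_ Xfin _|].
  exact: (ess_sup_inf.ess_supr_bounded Xfin).
by have := probability_setT P => /= ->; rewrite lte01.
Qed.

Lemma L1_mul_Loo F (g X : T -> R) : L1 P g -> Lp P F +oo%E X -> L1 P (g \* X).
Proof.
move=> ig lX; have [c Xc] := Loo_bounded lX.
apply: (L1_dominated _ (L1Z c ig)).
  by apply: measurable_funM; [exact: L1_measurable ig|exact: Lp_measurable lX].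
apply: filterS Xc => t Xc; rewrite /= !normrM mulrC.
by apply: ler_wpM2r => //; apply: le_trans Xc (ler_norm _).
Qed.

Variable V : (T -> R) -> T -> R.
Hypotheses (V_op : is_operator P Loo LA V) (V_lin : linear_operator P +oo%E V)
  (V_nneg : nonnegative_operator P +oo%E V) (V_reg : regular P +oo%E V).

Let LAV X : Loo X -> LA (V X). Proof. exact: V_op.1. Qed.

Let iV (g X : T -> R) : L1 P g -> Loo X -> L1 P (g \* V X).
Proof. by move=> ig /LAV; exact: L1_mul_Loo. Qed.

(** The functional [w X = E[g V X]] is positive, and regularity of [V] with dominated convergence
    makes it continuous along decreasing sets. Its conditional operator for the full sigma-algebra
    is multiplication by the density [b], its value at the constant 1. *)
Let adjoint_nneg (g : T -> R) : L1 P g -> (forall t, 0 <= g t) ->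
  exists2 b : T -> R, Lp P d.-measurable 1%E b &
    forall X, Loo X -> L1 P (b \* X) /\ Ev P (g \* V X) = Ev P (b \* X).
Proof.
move=> ig g0; pose w X := Ev P (g \* V X).
have wL a X Y : Loo X -> Loo Y -> w (a \*: X \+ Y) = a * w X + w Y.
  move=> lX lY; rewrite /w -EvL; try exact: iV.
  apply: eq_Ev; first by apply: iV => //; exact: LpL.
    by apply: L1L; exact: iV.
  apply: filterS (linear_operatorE V_lin a lX lY) => t /= ->.
  by rewrite mulrDr; congr (_ + _); rewrite mulrCA.
have w0 X : Loop X -> 0 <= w X.
  move=> lX; apply: Ev_ge0; first exact: iV lX.1.
  by apply: filterS (V_nneg lX) => t /= V0; rewrite mulr_ge0.
have wcont X (H_ : nat -> set T) : Loop X -> (forall n, measurable (H_ n)) ->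
    (forall n, H_ n.+1 `<=` H_ n) -> \bigcap_n H_ n = set0 ->
    w (\1_(H_ n) \* X) @[n --> \oo] --> 0.
  move=> lX mH Hdec H0.
  have lH n : Loop (\1_(H_ n) \* X) by exact: Lp_nneg_indicM.
  have Hmono n t : \1_(H_ n.+1) t <= \1_(H_ n) t :> R.
    rewrite !indicE ler_nat; case: (boolP (t \in H_ n.+1)) => // /set_mem/Hdec tH.
    by rewrite mem_set.
  have Hcvg := cvg_indic_decreasing Hdec H0.
  apply: (@cvg_Ev0 _ _ _ P (fun n => g \* V (\1_(H_ n) \* X)) (g \* V X)).
  - by move=> n; apply: L1_measurable; apply: iV => //; exact: (lH n).1.
  - exact: iV lX.1.
  - move=> n; have le : ae_le P (\1_(H_ n) \* X) X.
      apply: filterS lX.2 => t /= X0; rewrite indicE.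
      by case: (_ \in _); rewrite ?mul1r ?mul0r.
    have := positive_operator_le p1 V_lin V_nneg (lH n).1 lX.1 le.
    apply: filterS2 (V_nneg (lH n)) => t /= V0 VX.
    by rewrite normrM !ger0_norm// ler_wpM2l.
  have := V_reg (fun n => (lH n).1).
  have dec n : ae_le P (\1_(H_ n.+1) \* X) (\1_(H_ n) \* X).
    by apply: filterS lX.2 => t /= X0; rewrite ler_wpM2r.
  have X0 : ae_cvg P (fun n => \1_(H_ n) \* X) (cst 0).
    apply: aeW => t /=; have : \1_(H_ n) t * X t @[n --> \oo] --> 0 * X t.
      by apply: cvgMr_tmp; exact: Hcvg.
    by rewrite mul0r.
  move=> /(_ dec X0); apply: filterS => t /= V0.
  have : g t * V (\1_(H_ n) \* X) t @[n --> \oo] --> g t * 0.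
    by apply: cvgMl_tmp; exact: V0.
  by rewrite mulr0.
have l1 : Loo (cst 1) by exact: Lp_cst.
pose C := conditional_operator P d.-measurable w.
have [mb ib _] := conditional_operatorP cB cB p1 wL w0 wcont l1.
exists (C (cst 1)).
  by split; [exact/Lfun1_integrable|].
move=> X lX; have iCX := conditional_L1 cB cB p1 wL w0 wcont lX.
have X1 : X \* cst 1 = X by apply/funext => t /=; rewrite mulr1.
(* Here [X] plays the multiplier, acting on the constant 1. *)
have := conditional_homogeneous cB cB p1 wL w0 wcont l1 (Lp_mf lX).
rewrite X1 => /(_ lX) CX.
have mbX : measurable_fun [set: T] (C (cst 1) \* X).
  by apply: measurable_funM; [exact: L1_measurable ib|exact: Lp_measurable lX].
have CX' : \forall t \ae P, C X t = (C (cst 1) \* X) t.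
  by apply: filterS CX => t; rewrite mulrC.
have ibX := L1_eq_ae mbX iCX CX'; split => //.
by rewrite -(eq_Ev iCX ibX CX') (Ev_conditional cB cB p1 wL w0 wcont lX).
Qed.

Lemma adjoint_operator (g : T -> R) : L1 P g ->
  exists2 b : T -> R, Lp P d.-measurable 1%E b &
    forall X, Loo X -> L1 P (b \* X) /\ Ev P (g \* V X) = Ev P (b \* X).
Proof.
move=> ig.
have igp : L1 P g^\+ by exact: integrable_funrpos.
have ign : L1 P g^\- by exact: integrable_funrneg.
have [b lb bP] := adjoint_nneg igp (funrpos_ge0 g).
have [c lc cP] := adjoint_nneg ign (funrneg_ge0 g).
exists (b \- c); first exact: LpB.
move=> X lX; have [ibX bX] := bP _ lX; have [icX cX] := cP _ lX.
have -> : (b \- c) \* X = (b \* X) \- (c \* X).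
  by apply/funext => t /=; rewrite mulrBl.
split; first exact: L1B.
rewrite EvB// -bX -cX -EvB; try exact: iV.
congr Ev; apply/funext => t /=; rewrite -mulrBl; congr (_ * _).
by rewrite -[in LHS](funrposBneg g).
Qed.

Lemma expectation_Ev (X : T -> R) : L1 P X -> ('E_P[X])%E = (Ev P X)%:E.
Proof. by move=> iX; rewrite unlock /Ev /Rintegral fineK// integrable_fin_num. Qed.

(** A basic weak-star neighbourhood pulls back to one of the same radius, with the test functions
    replaced by their adjoints. *)
Lemma positive_operator_continuous_oo : continuous_operator P A +oo%E V.
Proof.
move=> X lX U; rewrite /Lp_nbhs eqxx => -[k [g [e [e0 lg gU]]]].
have ig i : L1 P (g i) by have [/Lfun1_integrable] := lg i.
have /choice[b bP] i : exists b : T -> R, Lp P d.-measurable 1%E b /\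
    forall X, Loo X -> L1 P (b \* X) /\ Ev P (g i \* V X) = Ev P (b \* X).
  by have [b lb bE] := adjoint_operator (ig i); exists b.
exists k, b, e; split => // [i|Y lY bY]; first by have [] := bP i.
apply: gU; first exact: LAV.
move=> i; have [_ bi] := bP i.
have lYX : Loo (Y \- X) by exact: LpB.
have [ibYX gE] := bi _ lYX.
have iVYX : L1 P (g i \* (V Y \- V X)).
  rewrite (_ : _ \* _ = (g i \* V Y) \- (g i \* V X)).
    by apply: L1B; exact: iV.
  by apply/funext => t /=; rewrite mulrBr.
have := bY i; rewrite !expectation_Ev//.
suff -> : Ev P (g i \* (V Y \- V X)) = Ev P (b i \* (Y \- X)) by [].
rewrite -gE; apply: eq_Ev => //; first exact: iV.
apply: filterS (linear_operatorB V_lin lY lX) => t.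
by rewrite /= => ->.
Qed.

End WeakStarContinuity.

(** * Conjugates and supporting operators *)

Section Conjugate.
Context {d : measure_display} {T : measurableType d} {R : realType}.
Variables (P : probability T R) (A : set (set T)) (p : \bar R).
Hypotheses (cA : complete_subalgebra P A)
  (cB : complete_subalgebra P d.-measurable) (p1 : (1 <= p)%E).

Local Notation LB := (Lp P d.-measurable p).
Local Notation LA := (Lp P A p).

Variables (L : set (T -> R)) (z V : (T -> R) -> T -> R).
Hypotheses (L_sub : L `<=` LB) (L_add : forall X Y, L X -> L Y -> L (X \+ Y))
  (L_one : L (cst 1)) (L_indic : forall H X, A H -> L X -> L (\1_H \* X)).
Hypotheses (z_op : is_operator P L LA z) (z_hom : weak_homogeneous_on P A L z).
Hypotheses (V_op : is_operator P LB LA V) (V_lin : linear_operator P p V)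
  (V_hom : homogeneous P A p V).

Let f X t := V X t - z X t.

Let mf_f X : L X -> mf A (f X).
Proof.
move=> lX; apply: (@measurable_funB _ (g_sigma_algebraType A)).
  by apply: Lp_mf; apply: V_op.1; exact: L_sub.
by apply: Lp_mf; exact: z_op.1.
Qed.

Let if_ X : L X -> L1 P (f X).
Proof.
move=> lX; apply: L1B; apply: (Lp_L1 p1); first by apply: V_op.1; exact: L_sub.
exact: z_op.1.
Qed.

Lemma conjugate_is_esssup :
  is_esssup P [set (fun t => (V X t - z X t)%:E) | X in L] (xstar P L z V).
Proof.
apply: (esssupP cA); first by exists (fun t => (f (cst 1) t)%:E), (cst 1).
by move=> _ [X lX <-]; apply/measurable_EFinP; exact: mf_f.
Qed.

Lemma conjugate_mf : mf A (xstar P L z V).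
Proof.
apply: mf_esssup => //; first by exists (fun t => (f (cst 1) t)%:E), (cst 1).
by move=> _ [X lX <-]; apply/measurable_EFinP; exact: mf_f.
Qed.

Lemma conjugate_ge X : L X -> \forall t \ae P, ((V X t - z X t)%:E <= xstar P L z V t)%E.
Proof. by move=> lX; have [_ + _] := conjugate_is_esssup; apply; exists X. Qed.

Lemma set0_subalgebra : A set0.
Proof. by case: cA => -[]. Qed.

Let indic0M (X : T -> R) : \1_set0 \* X = cst 0.
Proof. by apply/funext => t /=; rewrite indic0 mul0r. Qed.

Let L0 : L (cst 0).
Proof. by have := L_indic set0_subalgebra L_one; rewrite indic0M. Qed.

Lemma weak_homogeneous0 : \forall t \ae P, z (cst 0) t = 0.
Proof.
have := z_hom set0_subalgebra L_one; rewrite !indic0M.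
by apply: filterS => t /(_ I).
Qed.

Let f0 : \forall t \ae P, f (cst 0) t = 0.
Proof.
apply: filterS2 (linear_operator0 cB p1 V_lin) weak_homogeneous0 => t.
by rewrite /f => -> ->; rewrite subrr.
Qed.

Lemma conjugate_ge0 : \forall t \ae P, (0 <= xstar P L z V t)%E.
Proof.
by apply: filterS2 f0 (conjugate_ge L0) => t; rewrite /f => ->.
Qed.

(** This is what lets the essential supremum be approached by values at single elements of [L], and
    hence its integral by expectations. *)
Let paste X Y : L X -> L Y ->
  exists2 W, L W & \forall t \ae P, f W t = Num.max (f X t) (f Y t).
Proof.
move=> lX lY; have AH := subalgebra_lt cA (mf_f lX) (mf_f lY).
set H := [set t | _] in AH; have AHC := subalgebraC cA AH.
pose W := (\1_H \* Y) \+ (\1_(~` H) \* X).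
have lW : L W by apply: L_add; exact: L_indic.
exists W => //.
(* [z] is not additive, so [f W] is not computed from its two summands: it is read off on [H] and on
   its complement separately, through weak homogeneity. *)
have HW : \1_H \* W = \1_H \* Y.
  apply/funext => t; rewrite /W /= !indicE in_setC.
  by case: (_ \in _); rewrite ?mul1r ?mul0r ?addr0.
have HCW : \1_(~` H) \* W = \1_(~` H) \* X.
  apply/funext => t; rewrite /W /= !indicE in_setC.
  by case: (_ \in _); rewrite /= ?mul1r ?mul0r ?add0r.
have fH K U : A K -> L U -> \forall t \ae P, f (\1_K \* U) t = \1_K t * f U t.
  move=> AK lU; have lK : LA (\1_K : T -> R).
    have := Lp_indicM p1 cA AK (Lp_cst p1 1 cA); congr (Lp P A p).
    by apply/funext => t /=; rewrite mulr1.
  apply: filterS2 (z_hom AK lU) (V_hom (L_sub lU) lK (L_sub (L_indic AK lU))) => t.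
  by rewrite /f => /(_ I) -> /(_ I) -> /=; rewrite mulrBr.
have := fH _ _ AH lW; have := fH _ _ AHC lW; rewrite HW HCW => WX WY.
have E1 : \forall t \ae P, \1_H t * f W t = \1_H t * f Y t.
  by apply: filterS2 WY (fH _ _ AH lY) => t -> ->.
have E2 : \forall t \ae P, \1_(~` H) t * f W t = \1_(~` H) t * f X t.
  by apply: filterS2 WX (fH _ _ AHC lX) => t -> ->.
apply: filterS2 E1 E2 => t; rewrite !indicE in_setC.
have [|/negP] := boolP (t \in H); rewrite inE /H/= => XY.
  by rewrite !mul1r => -> _; rewrite max_r// ltW.
by rewrite !mul1r => _ ->; rewrite max_l// leNgt; exact/negP.
Qed.

(* Partial maxima of countably many [f X_i] are again of the form [f W] with
   [W] in [L], by pasting along sets of [A]. *)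
Lemma integral_conjugate_le c : (forall X, L X -> Ev P (f X) <= c) ->
  (\int[P]_t xstar P L z V t <= c%:E)%E.
Proof.
move=> fc.
have mS h : [set (fun t => (V X t - z X t)%:E) | X in L] h -> mf A h.
  by move=> [X lX <-]; apply/measurable_EFinP; exact: mf_f.
have [|h [Sh hP]] := countable_esssup cA _ mS.
  by exists (fun t => (f (cst 1) t)%:E), (cst 1).
have /choice[X XP] n : exists X, L X /\ (fun t => (f X t)%:E) = h n.
  by have [X lX <-] := Sh n; exists X.
(* The initial value 0 is a.e. [f (cst 0)]; it makes the [k n] nonnegative, as monotone convergence
   requires, without exceeding the conjugate. *)
pose k := fix k n t := if n is n'.+1 then Num.max (k n' t) (f (X n') t) else 0.
have kW n : exists2 W, L W & \forall t \ae P, f W t = k n t.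
  elim: n => [|n [W lW fW]]; first by exists (cst 0).
  have [W' lW' fW'] := paste lW (XP n).1; exists W' => //.
  by apply: filterS2 fW fW' => t /= <-.
have mk n : measurable_fun [set: T] (k n).
  elim: n => [|n IHn] /=; first exact: measurable_cst.
  apply: measurable_maxr => //; apply: L1_measurable; apply: if_; exact: (XP n).1.
have k0 n t : 0 <= k n t by elim: n => [|n IHn] //=; rewrite le_max IHn.
have knd t : {homo (fun n => k n t) : a b / (a <= b)%N >-> a <= b}.
  by apply/nondecreasing_seqP => n /=; rewrite le_max lexx.
pose s t := limn (fun n => (k n t)%:E).
have kcvg t : cvgn (fun n => (k n t)%:E).
  by apply: ereal_nondecreasing_is_cvgn => a b ab; rewrite lee_fin; exact: knd.
have ks n t : ((k n t)%:E <= s t)%E.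
  apply: lime_ge (kcvg t) _; exists n => // l /= nl.
  by rewrite lee_fin; exact: knd.
have Ik n : (\int[P]_t (k n t)%:E <= c%:E)%E.
  have [W lW fW] := kW n.
  have iW := if_ lW.
  rewrite (@ae_eq_integral _ _ _ P _ (EFin \o f W))//.
  - by rewrite -[leLHS]fineK ?integrable_fin_num// lee_fin; exact: fc.
  - exact/measurable_EFinP.
  - exact: measurable_int iW.
  - by apply: filterS fW => t /= -> _.
have ms : measurable_fun [set: T] s.
  apply: (@emeasurable_fun_cvg _ _ _ _ (fun n => EFin \o k n)).
    by move=> n; exact/measurable_EFinP.
  by move=> t _; exact: kcvg.
have Is : (\int[P]_t s t <= c%:E)%E.
  rewrite monotone_convergence//.
  - apply: lime_le; last exact: nearW.
    apply: ereal_nondecreasing_is_cvgn => a b ab; apply: ge0_le_integral => //.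
    + by move=> t _; rewrite lee_fin.
    + exact/measurable_EFinP.
    + exact/measurable_EFinP.
    + by move=> t _; rewrite lee_fin; exact: knd.
  - by move=> n; exact/measurable_EFinP.
  - by move=> n t _; rewrite lee_fin.
  - by move=> t _ a b ab; rewrite lee_fin; exact: knd.
apply: le_trans Is; rewrite (@ae_eq_integral _ _ _ P _ s)//.
- by have := subalgebra_measurable_fun cA conjugate_mf; exact.
have := is_esssup_ae_eq conjugate_is_esssup hP.
have hx := ae_foralln (fun n => conjugate_ge (XP n).1).
apply: filterS3 conjugate_ge0 hx => t x0 hx xE _.
apply/eqP; rewrite eq_le; apply/andP; split.
  rewrite xE; apply: pointwise_sup_le => n; rewrite -(XP n).2.
  by apply: le_trans (ks n.+1 t); rewrite lee_fin /= le_max lexx orbT.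
apply: lime_le (kcvg t) _; apply: nearW => n.
elim: n => [//|n IHn] /=; rewrite EFin_max ge_max IHn; exact: hx.
Qed.

End Conjugate.

(** * Operators between [m] and [M] that support a convex operator at a given point *)

Section SupportingOperator.
Context {d : measure_display} {T : measurableType d} {R : realType}.
Variables (P : probability T R) (A : set (set T)) (p : \bar R).
Hypotheses (cA : complete_subalgebra P A)
  (cB : complete_subalgebra P d.-measurable) (p1 : (1 <= p)%E).

Local Notation LB := (Lp P d.-measurable p).
Local Notation LA := (Lp P A p).
Local Notation LBp := (Lp_nneg P d.-measurable p).
Local Notation LAp := (Lp_nneg P A p).

Variables m M : (T -> R) -> T -> R.
Hypotheses (m_op : is_operator P LBp LAp m) (M_op : is_operator P LBp LAp M).
Hypotheses (m_hom : weak_homogeneous_on P A LBp m)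
  (M_hom : weak_homogeneous_on P A LBp M).
Hypotheses (m_sup : superlinear P p m) (M_sub : sublinear P p M).
Hypothesis M_reg : p = +oo%E -> regular P p M.

Variables (L : set (T -> R)) (z : (T -> R) -> T -> R).
Hypotheses (L_sub : L `<=` LB) (L_add : forall X Y, L X -> L Y -> L (X \+ Y))
  (L_scale : forall a X, L X -> L (a \*: X)) (L_one : L (cst 1))
  (L_indic : forall H X, A H -> L X -> L (\1_H \* X)).
Hypotheses (z_op : is_operator P L LA z) (z_conv : convex_on P L z)
  (z_hom : weak_homogeneous_on P A L z) (z_sand : sandwich P p m M L z).

Let AB (H : set T) : A H -> d.-measurable H.
Proof. by case: cA => _ + _; exact. Qed.

Let iz X : L X -> L1 P (z X).
Proof. by move=> /(proj1 z_op); exact: Lp_L1. Qed.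

Let im X : LBp X -> L1 P (m X).
Proof. by move=> /(proj1 m_op)[+ _]; exact: Lp_L1. Qed.

Let iM X : LBp X -> L1 P (M X).
Proof. by move=> /(proj1 M_op)[+ _]; exact: Lp_L1. Qed.

Let L_cst0 : L (cst 0).
Proof.
by have := L_scale 0 L_one; congr L; apply/funext => t /=; rewrite scale0r.
Qed.

(** The ambient vector space is that of all functions, and the cone [LBp] contains the functions
    that vanish a.e., so its order is the a.e. order. It generates L_p by positive parts. *)
Lemma operator_functional X0 : L X0 -> exists v : (T -> R) -> R,
  [/\ forall a X Y, LB X -> LB Y -> v (a \*: X \+ Y) = a * v X + v Y,
      forall Z, LBp Z -> Ev P (m Z) <= v Z /\ v Z <= Ev P (M Z)
    & forall X, L X -> v X - Ev P (z X) <= v X0 - Ev P (z X0)].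
Proof.
apply: (@sandwich_functional R (T -> R) LB LBp L (fun X => Ev P (z X))
  (fun X => Ev P (m X)) (fun X => Ev P (M X))).
- exact: Lp_cst.
- by move=> a X Y; exact: LpL.
- by move=> X [].
- move=> X lX; exists X^\+; first exact: Lp_funrpos.
  rewrite (_ : _ - _ = X^\-); first exact: Lp_funrneg.
  apply/funext => t; rewrite -[LHS]/(X^\+ t - X t).
  have -> : X t = X^\+ t - X^\- t by rewrite -[in LHS](funrposBneg X).
  by rewrite opprB addrCA subrr addr0.
- by move=> X Y; exact: Lp_nnegD.
- by move=> a X a0; exact: Lp_nnegZ.
- by [].
- exact: L_cst0.
- by move=> a X Y lX lY; apply: L_add => //; exact: L_scale.
- move=> X Y l lX lY l01.
  have -> : l * Ev P (z X) + (1 - l) * Ev P (z Y) =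
      Ev P (l \*: z X \+ (1 - l) \*: z Y).
    by rewrite EvD ?EvZ//; do ?apply: L1Z; exact: iz.
  apply: le_Ev; [|by apply: L1D; apply: L1Z; exact: iz|exact: z_conv].
  by apply: iz; apply: L_add; exact: L_scale.
- move=> X Y lX lY; rewrite -EvD; try exact: im.
  apply: le_Ev; first by apply: L1D; exact: im.
    by apply: im; exact: Lp_nnegD.
  exact: m_sup.1.
- move=> a X lX a0; rewrite -EvZ; last exact: im.
  apply: eq_Ev; [by apply: im; exact: Lp_nnegZ|by apply: L1Z; exact: im|].
  by apply: filterS (m_sup.2 X a lX a0) => t; exact.
- move=> X Y lX lY; rewrite -EvD; try exact: iM.
  apply: le_Ev; last exact: M_sub.1.
    by apply: iM; exact: Lp_nnegD.
  by apply: L1D; exact: iM.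
- move=> a X lX a0; rewrite -EvZ; last exact: iM.
  apply: eq_Ev; [by apply: iM; exact: Lp_nnegZ|by apply: L1Z; exact: iM|].
  by apply: filterS (M_sub.2 X a lX a0) => t; exact.
- move=> X Y Z lX lY lZ [_ XYZ]; rewrite -EvD; [|exact: im|exact: iz].
  apply: le_Ev; [by apply: L1D; [exact: im|exact: iz]|exact: iM|].
  apply: z_sand => //; apply: filterS XYZ => t /=.
  by rewrite -addrA -opprD subr_ge0.
Qed.

(** Membership in [VS] without the condition on the conjugate, the only one that involves [L] and
    [z]. *)
Definition dominated_operator (V : (T -> R) -> T -> R) :=
  [/\ is_operator P LB LA V,
      [/\ linear_operator P p V, continuous_operator P A p V,
          nonnegative_operator P p V & homogeneous P A p V]
    & forall X, LBp X -> ae_le P (m X) (V X) /\ ae_le P (V X) (M X)].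

Lemma dominated_operator_continuous (V : (T -> R) -> T -> R) :
  is_operator P LB LA V -> linear_operator P p V -> nonnegative_operator P p V ->
  (forall X, LBp X -> ae_le P (V X) (M X)) -> continuous_operator P A p V.
Proof.
move=> V_op V_lin V_nneg VM.
have [poo|pN] := eqVneq p +oo%E; last exact: positive_operator_continuous_fin.
have V_reg : regular P p V.
  move=> X lX Xdec X0.
  (* The bound of [V] by [M] holds on the positive cone, where a sequence decreasing to 0 lies;
     there [0 <= V (X n) <= M (X n)] transfers regularity from [M] to [V]. *)
  have Xn n : LBp (X n).
    split=> //; have := ae_foralln (fun k => Xdec (n + k)%N).
    apply: filterS2 X0 => t Xt dec /=.
    have le k : X (n + k)%N t <= X n t.
      elim: k => [|k IHk]; first by rewrite addn0.
      by apply: le_trans IHk; rewrite addnS; exact: dec.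
    apply: (cvgr_to_le Xt); exists n => // k /= nk.
    by rewrite -(subnKC nk); exact: le.
  have := M_reg poo lX Xdec X0.
  have VX := ae_foralln (fun n => VM _ (Xn n)).
  have V0 := ae_foralln (fun n => V_nneg _ (Xn n)).
  apply: filterS3 VX V0 => t VX V0 M0.
  apply: (squeeze_cvgr (f := cst 0) (h := fun n => M (X n) t)) => //.
    by apply: nearW => n; rewrite /= V0 VX.
  exact: cvg_cst.
move: V_op V_lin V_nneg V_reg; rewrite poo => *.
exact: positive_operator_continuous_oo.
Qed.

(** Weak homogeneity of [m] and [M] takes indicators of sets of [A] out of the operators, so the
    scalar bounds on [v] hold on each such set and localize to a.e. bounds on [V]. The bound by [M]
    also gives continuity of [v] along decreasing sets. *)
Lemma functional_operator (v : (T -> R) -> R) :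
  (forall a X Y, LB X -> LB Y -> v (a \*: X \+ Y) = a * v X + v Y) ->
  (forall Z, LBp Z -> Ev P (m Z) <= v Z /\ v Z <= Ev P (M Z)) ->
  exists V, dominated_operator V /\ forall X, LB X -> Ev P (V X) = v X.
Proof.
move=> vL vmM.
have v0 X : LBp X -> 0 <= v X.
  move=> lX; apply: le_trans (vmM _ lX).1; apply: Ev_ge0; first exact: im.
  by have [] := m_op.1 _ lX.
have EM H X : A H -> LBp X -> Ev P (M (\1_H \* X)) = Ev P (\1_H \* M X).
  move=> AH lX; have mH := AB AH.
  apply: eq_Ev; first by apply: iM; exact: Lp_nneg_indicM.
    by apply: L1_indic => //; exact: iM.
  by apply: filterS (M_hom AH lX) => t; exact.
have Em H X : A H -> LBp X -> Ev P (m (\1_H \* X)) = Ev P (\1_H \* m X).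
  move=> AH lX; have mH := AB AH.
  apply: eq_Ev; first by apply: im; exact: Lp_nneg_indicM.
    by apply: L1_indic => //; exact: im.
  by apply: filterS (m_hom AH lX) => t; exact.
have vcont X (H_ : nat -> set T) : LBp X -> (forall n, A (H_ n)) ->
    (forall n, H_ n.+1 `<=` H_ n) -> \bigcap_n H_ n = set0 ->
    v (\1_(H_ n) \* X) @[n --> \oo] --> 0.
  move=> lX AH Hdec H0.
  have lH n : LBp (\1_(H_ n) \* X) by apply: Lp_nneg_indicM => //; exact: AB.
  have iMX := iM lX; have MX0 := (M_op.1 _ lX).2.
  have Hcvg := cvg_indic_decreasing Hdec H0.
  apply: (squeeze_cvgr (f := cst 0) (h := fun n => Ev P (\1_(H_ n) \* M X))).
  - apply: nearW => n; rewrite /= v0//= -EM//; exact: (vmM _ (lH n)).2.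
  - exact: cvg_cst.
  apply: (cvg_Ev0 _ iMX).
  - move=> n; apply: L1_measurable; apply: L1_indic iMX; exact: AB.
  - move=> n; apply: filterS MX0 => t /= M0; rewrite normrM indicE.
    by case: (_ \in _); rewrite ?normr1 ?normr0 ?mul1r ?mul0r ?ger0_norm.
  apply: aeW => t /=.
  have : \1_(H_ n) t * M X t @[n --> \oo] --> 0 * M X t.
    by apply: cvgMr_tmp; exact: Hcvg.
  by rewrite mul0r.
pose V := conditional_operator P A v; exists V.
have VM X : LBp X -> ae_le P (V X) (M X).
  move=> lX; apply: (conditional_upper_bound cA cB p1 vL v0 vcont lX.1).
  - exact: Lp_mf (M_op.1 _ lX).1.
  - exact: iM.
  move=> H AH; rewrite -EM//; apply: (vmM _ _).2.
  by apply: Lp_nneg_indicM => //; exact: AB.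
have mV X : LBp X -> ae_le P (m X) (V X).
  move=> lX; apply: (conditional_lower_bound cA cB p1 vL v0 vcont lX.1).
  - exact: Lp_mf (m_op.1 _ lX).1.
  - exact: im.
  move=> H AH; rewrite -Em//; apply: (vmM _ _).1.
  by apply: Lp_nneg_indicM => //; exact: AB.
have V_lin : linear_operator P p V.
  move=> a X Y lX lY; have := conditional_linear cA cB p1 vL v0 vcont a lX lY.
  by apply: filterS => t + _.
have V_nneg : nonnegative_operator P p V.
  by move=> X; exact: conditional_ge0.
have V_op : is_operator P LB LA V.
  split=> [X lX|X Y lX lY XY].
    (* The density is only known to be in L_1; it is in L_p because [|V X| <= V |X| <= M |X|]. *)
    have lNX : LBp (fun t => `|X t|).
      by split; [exact: Lp_normr|apply: aeW => t /=].
    have XN : \forall t \ae P, `|X t| <= (fun t => `|X t|) t by exact: aeW.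
    have VX := positive_operator_norm cB p1 V_lin V_nneg lX lNX.1 XN.
    apply: (Lp_dominated p1 cA (M_op.1 _ lNX).1).
      by have := conditional_mf cA cB p1 vL v0 vcont lX; exact.
    apply: filterS2 VX (VM _ lNX) => t VX /(le_trans VX)/le_trans; apply.
    exact: ler_norm.
  have {}XY : \forall t \ae P, X t = Y t by apply: filterS XY => t; exact.
  have := conditional_eq cA cB p1 vL v0 vcont lX lY XY.
  by apply: filterS => t + _.
split; last by move=> X lX; exact: (Ev_conditional cA cB p1 vL v0 vcont lX).
split => //; last by move=> X lX; split; [exact: mV|exact: VM].
split => //; first exact: dominated_operator_continuous.
move=> X xi lX lxi lxiX.
have := conditional_homogeneous cA cB p1 vL v0 vcont lX (Lp_mf lxi) lxiX.
by apply: filterS => t + _.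
Qed.

(* The maximizer of [v X - E (z X)] over [L] is [X0]; since the integral of the
   conjugate is the supremum of these numbers, the Fenchel inequality at [X0]
   holds with equality almost surely. *)
Lemma supporting_operator X0 : L X0 -> exists V,
  [/\ dominated_operator V, (\int[P]_t xstar P L z V t < +oo)%E
    & \forall t \ae P, xstar P L z V t = (V X0 t - z X0 t)%:E].
Proof.
move=> lX0; have [v [vL vmM vX]] := operator_functional lX0.
have [V [VD VE]] := functional_operator vL vmM.
have [V_op [V_lin _ V_nneg V_hom] _] := VD.
set s := xstar P L z V.
have iV X : L X -> L1 P (V X) by move=> lX; apply: (Lp_L1 p1); exact: V_op.1 (L_sub lX).
have Ic : (\int[P]_t s t <= (Ev P (V X0 \- z X0))%:E)%E.
  apply: (integral_conjugate_le cA cB p1 L_sub L_add L_one L_indic z_op z_hom V_op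
    V_lin V_hom) => X lX.
  by rewrite !EvB ?VE//; try exact: L_sub; [exact: vX|exact: iV|exact: iz|exact: iV|exact: iz].
have ms : measurable_fun [set: T] s.
  have := subalgebra_measurable_fun cA (conjugate_mf cA L_sub L_one z_op V_op).
  exact.
have s0 := conjugate_ge0 cA cB p1 L_sub L_one L_indic z_op z_hom V_op V_lin.
have sX0 := conjugate_ge cA L_sub L_one z_op V_op lX0.
have Ioo : (\int[P]_t s t < +oo)%E by apply: le_lt_trans Ic _; rewrite ltry.
have is_ : P.-integrable [set: T] s.
  apply/integrableP; split => //; rewrite (@ae_eq_integral _ _ _ P _ s)//.
    exact: measurableT_comp.
  by apply: filterS s0 => t s0 _; rewrite gee0_abs.
have sfin := integrable_ae measurableT is_.
have sE : \forall t \ae P, (fine (s t))%:E = s t.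
  by apply: filterS sfin => t /(_ I) ?; rewrite fineK.
have ifs : L1 P (fine \o s).
  apply/integrableP; split; first by apply/measurable_EFinP; exact: measurableT_comp.
  rewrite (@ae_eq_integral _ _ _ P _ (abse \o s))//.
  - by have /integrableP[_] := is_.
  - by apply: measurableT_comp => //; apply/measurable_EFinP; exact: measurableT_comp.
  - exact: measurableT_comp.
  - by apply: filterS sE => t sE _; exact: (congr1 abse sE).
have iVz : L1 P (V X0 \- z X0) by apply: L1B; [exact: iV|exact: iz].
have d0 : \forall t \ae P, ((fine \o s) \- (V X0 \- z X0)) t = 0.
  apply: Ev_eq0; first exact: L1B.
    apply: filterS2 sE sX0 => t sE; rewrite -/s -sE lee_fin /=.
    by rewrite subr_ge0.
  rewrite EvB// subr_le0 -lee_fin; apply: le_trans Ic; rewrite le_eqVlt; apply/orP; left.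
  apply/eqP; rewrite /Ev /Rintegral fineK; last exact: integrable_fin_num.
  apply: ae_eq_integral => //; first exact: measurable_int ifs.
  by apply: filterS sE => t /= -> _.
exists V; split => //.
apply: filterS2 d0 sE => t /= d0 sE; rewrite -[LHS]/(s t) -sE; congr EFin; lra.
Qed.

End SupportingOperator.

(** * The maximal extension *)

Section MaximalExtension.
Context {d : measure_display} {T : measurableType d} {R : realType}.
Variables (P : probability T R) (A : set (set T)) (p : \bar R).
Hypotheses (cA : complete_subalgebra P A)
  (cB : complete_subalgebra P d.-measurable) (p1 : (1 <= p)%E).

Local Notation LB := (Lp P d.-measurable p).
Local Notation LA := (Lp P A p).
Local Notation LBp := (Lp_nneg P d.-measurable p).
Local Notation LAp := (Lp_nneg P A p).

Variables m M : (T -> R) -> T -> R.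
Hypotheses (m_op : is_operator P LBp LAp m) (M_op : is_operator P LBp LAp M).
Hypotheses (m_hom : weak_homogeneous_on P A LBp m)
  (M_hom : weak_homogeneous_on P A LBp M).
Hypotheses (m_sup : superlinear P p m) (M_sub : sublinear P p M).
Hypothesis M_reg : p = +oo%E -> regular P p M.

(** Domain and operator are left free: the lemma serves [x] on [L] as well as a competing extension
    on all of L_p. *)
Lemma VS_supporting_operator (L : set (T -> R)) (z : (T -> R) -> T -> R) :
  L `<=` LB -> (forall X Y, L X -> L Y -> L (X \+ Y)) ->
  (forall a X, L X -> L (a \*: X)) -> L (cst 1) ->
  (forall H X, A H -> L X -> L (\1_H \* X)) ->
  is_operator P L LA z -> convex_on P L z -> weak_homogeneous_on P A L z ->
  sandwich P p m M L z -> forall X0, L X0 ->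
  exists2 V, VS P A p L z m M V &
    \forall t \ae P, xstar P L z V t = (V X0 t - z X0 t)%:E.
Proof.
move=> L_sub L_add L_scale L_one L_indic z_op z_conv z_hom z_sand X0 lX0.
have [V [[V_op V_prop V_bnd] Ioo sE]] := supporting_operator cA cB p1 m_op M_op
  m_hom M_hom m_sup M_sub M_reg L_sub L_add L_scale L_one L_indic z_op z_conv
  z_hom z_sand lX0.
by exists V.
Qed.

Variables (L : set (T -> R)) (x : (T -> R) -> T -> R).
Hypotheses (L_sub : L `<=` LB) (L_add : forall X Y, L X -> L Y -> L (X \+ Y))
  (L_scale : forall a X, L X -> L (a \*: X)) (L_one : L (cst 1))
  (L_indic : forall H X, A H -> L X -> L (\1_H \* X)).
Hypotheses (x_op : is_operator P L LA x) (x_conv : convex_on P L x)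
  (x_hom : weak_homogeneous_on P A L x) (x_proj : projection_on P A p L x)
  (x_sand : sandwich P p m M L x).

Local Notation V_set := (VS P A p L x m M).
Local Notation x_conj := (xstar P L x).

Let L_cst c : L (cst c).
Proof.
have := L_scale c L_one; congr L; apply/funext => t /=.
by rewrite -[LHS]/(c * 1) mulr1.
Qed.

Definition conj_fin V t : R := fine (x_conj V t).

Local Notation s := conj_fin.

Section fix_V.
Variable V : (T -> R) -> T -> R.
Hypothesis VV : V_set V.

Let V_op : is_operator P LB LA V. Proof. by case: VV. Qed.
Let V_lin : linear_operator P p V. Proof. by case: VV => _ [[]]. Qed.
Let V_nneg : nonnegative_operator P p V. Proof. by case: VV => _ [[]]. Qed.

Lemma VS_conjugate_ge0 : \forall t \ae P, (0 <= x_conj V t)%E.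
Proof.
exact: (conjugate_ge0 cA cB p1 L_sub L_one L_indic x_op x_hom V_op V_lin).
Qed.

Let mconj : measurable_fun [set: T] (x_conj V).
Proof.
by have := subalgebra_measurable_fun cA (conjugate_mf cA L_sub L_one x_op V_op); exact.
Qed.

Let iconj : P.-integrable [set: T] (x_conj V).
Proof.
have [_ [_ [Ioo _]]] := VV.
apply/integrableP; split => //; rewrite (@ae_eq_integral _ _ _ P _ (x_conj V))//.
  exact: measurableT_comp.
by apply: filterS VS_conjugate_ge0 => t s0 _; rewrite gee0_abs.
Qed.

Lemma conj_finE : \forall t \ae P, x_conj V t = (s V t)%:E.
Proof.
by apply: filterS (integrable_ae measurableT iconj) => t /(_ I) ?; rewrite fineK.
Qed.

Lemma conj_fin_ge0 : \forall t \ae P, 0 <= s V t.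
Proof. by apply: filterS2 VS_conjugate_ge0 conj_finE => t + sE; rewrite sE lee_fin. Qed.

Lemma conj_fin_L1 : L1 P (s V).
Proof.
have ms : measurable_fun [set: T] (s V) by exact: measurableT_comp.
apply/integrableP; split; first exact/measurable_EFinP.
rewrite (@ae_eq_integral _ _ _ P _ (abse \o x_conj V))//.
- by have /integrableP[_] := iconj.
- by apply: measurableT_comp => //; exact/measurable_EFinP.
- exact: measurableT_comp.
- by apply: filterS conj_finE => t sE _; exact: (congr1 abse (esym sE)).
Qed.

Lemma conj_fin_mf : mf A (s V).
Proof.
have mc := conjugate_mf cA L_sub L_one x_op V_op.
exact: (@measurableT_comp _ _ _ (g_sigma_algebraType A) _ _ fine).
Qed.

Lemma conj_fin_ge X : L X -> \forall t \ae P, V X t - x X t <= s V t.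
Proof.
move=> lX; have := conjugate_ge cA L_sub L_one x_op V_op lX.
by apply: filterS2 conj_finE => t ->; rewrite lee_fin.
Qed.

Lemma VS_le X : LB X -> \forall t \ae P, V X t <= M X^\+ t.
Proof.
move=> lX; have lXp := Lp_funrpos p1 cB lX.
have [_ [_ [_ /(_ _ lXp)[_ VM]]]] := VV.
have XXp : ae_le P X X^\+ by apply: aeW => t; rewrite /funrpos le_max lexx.
apply: filterS2 VM (positive_operator_le p1 V_lin V_nneg lX lXp.1 XXp) => t VM.
by move=> /le_trans; apply.
Qed.

Lemma VS_ge X : LB X -> \forall t \ae P, - M X^\- t <= V X t.
Proof.
move=> lX; have lXp := Lp_funrpos p1 cB lX; have lXn := Lp_funrneg p1 cB lX.
have [_ [_ [_ /(_ _ lXn)[_ VM]]]] := VV.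
have V0 := V_nneg lXp.
apply: filterS3 VM V0 (linear_operatorB V_lin lXp.1 lXn.1) => t VM V0.
rewrite (_ : _ \- _ = X); first by move=> ->; move: VM V0 => /=; lra.
by apply/funext => u; rewrite -[in RHS](funrposBneg X).
Qed.

(* [x (c 1) = c] forces [c (V 1 - 1) <= x^*(V)] for every integer [c]. *)
Lemma VS_one : \forall t \ae P, V (cst 1) t = 1.
Proof.
pose c (b : bool) n : R := if b then n%:R else - n%:R.
have ge b n : \forall t \ae P, c b n * (V (cst 1) t - 1) <= s V t.
  have l1 : LB (cst 1) by exact: L_sub.
  have xc : \forall t \ae P, x (cst (c b n)) t = c b n.
    by apply: filterS (x_proj (Lp_cst p1 (c b n) cA) (L_cst (c b n))) => t; exact.
  apply: filterS3 xc (conj_fin_ge (L_cst (c b n))) (linear_operatorZ cB p1 V_lin (c b n) l1).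
  move=> t ->; rewrite (_ : c b n \*: cst 1 = cst (c b n)).
    by move=> le VE; rewrite VE in le; rewrite mulrBr mulr1.
  by apply/funext => u /=; rewrite -[LHS]/(c b n * 1) mulr1.
apply: filterS2 (ae_foralln (ge true)) (ae_foralln (ge false)) => t up lo.
apply/eqP; rewrite -subr_eq0; set D := _ - _ in up lo *.
apply: contraT => D0.
have nD : 0 < `|D| by rewrite normr_gt0.
have [n nD'] : exists n : nat, s V t < n%:R * `|D|.
  exists (Num.truncn (`|s V t| / `|D|)).+1.
  rewrite -ltr_pdivrMr//; apply: le_lt_trans (truncnS_gt _).
  by rewrite ler_pM2r ?invr_gt0// ler_norm.
have := up n; have := lo n; rewrite /c /=.
have [D1|D1] := leP 0 D.
  by rewrite ger0_norm// in nD'; lra.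
by rewrite ltr0_norm// in nD'; lra.
Qed.

(** Homogeneity with multiplier [X] reduces this to [V 1 = 1]. *)
Lemma VS_projection X : LA X -> \forall t \ae P, V X t = X t.
Proof.
move=> lX; have lXB := LpT lX; have l1 : LB (cst 1) by exact: L_sub.
have X1 : X \* cst 1 = X by apply/funext => t /=; rewrite mulr1.
have [_ [[_ _ _ V_hom] _]] := VV.
have := V_hom _ _ l1 lX; rewrite X1 => /(_ lXB).
by apply: filterS2 VS_one => t /= -> /(_ I) ->; rewrite /= mulr1.
Qed.

End fix_V.
(** The operator supporting [x] at 0, where both [V] and [x] vanish. It shows that the family is
    nonempty and that 0 is the least conjugate, which settles all lower bounds below. *)
Lemma VS_conjugate0 : exists2 V, V_set V & \forall t \ae P, s V t = 0.
Proof.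
have [V VV VE] := VS_supporting_operator L_sub L_add L_scale L_one L_indic x_op
  x_conv x_hom x_sand (L_cst 0).
exists V => //.
have [_ [[V_lin _ _ _] _]] := VV.
apply: filterS3 VE (linear_operator0 cB p1 V_lin)
  (weak_homogeneous0 cA L_one x_hom) => t + V0 x0.
by rewrite /conj_fin V0 x0 subrr => ->.
Qed.

Let S X := [set (fun t => (V X t)%:E - x_conj V t)%E | V in V_set].

Let mS X h : LB X -> S X h -> mf A h.
Proof.
move=> lX [V VV <-]; have V_op : is_operator P LB LA V by case: VV.
apply: (@emeasurable_funB _ (g_sigma_algebraType A)).
  by apply/measurable_EFinP; apply: Lp_mf; exact: V_op.1.
by have := conjugate_mf cA L_sub L_one x_op V_op; exact.
Qed.

Let S0 X : S X !=set0.
Proof. by have [V VV _] := VS_conjugate0; exists (fun t => (V X t)%:E - x_conj V t)%E, V. Qed.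

Lemma xhat_is_esssup X : LB X -> is_esssup P (S X) (xhat P A p L x m M X).
Proof. by move=> lX; apply: (esssupP cA (S0 X)) => h; exact: mS. Qed.

Definition max_extension X t : R := fine (xhat P A p L x m M X t).

Local Notation y := max_extension.

(** The essential supremum lies a.e. between the real-valued [V X], for a [V] with zero conjugate,
    and [M X^\+]. *)
Lemma max_extensionE X : LB X ->
  \forall t \ae P, xhat P A p L x m M X t = (y X t)%:E.
Proof.
move=> lX; have [_ ub least] := xhat_is_esssup lX.
have lXp := Lp_funrpos p1 cB lX.
have up : \forall t \ae P, (xhat P A p L x m M X t <= (M X^\+ t)%:E)%E.
  apply: least.
    by apply/measurable_EFinP; exact: Lp_measurable (M_op.1 _ lXp).1.
  move=> _ [V VV <-]; apply: filterS3 (VS_le VV lX) (conj_finE VV) (conj_fin_ge0 VV).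
  by move=> t VM -> s0; rewrite -EFinB lee_fin; lra.
have [V VV V0] := VS_conjugate0.
have lo : \forall t \ae P, ((V X t)%:E <= xhat P A p L x m M X t)%E.
  have : S X (fun t => (V X t)%:E - x_conj V t)%E by exists V.
  move=> /ub; apply: filterS3 V0 (conj_finE VV) => t -> ->.
  by rewrite sube0.
apply: filterS2 up lo => t up lo; rewrite fineK//.
by rewrite fin_numElt (lt_le_trans _ lo) ?ltNyr//= (le_lt_trans up) ?ltry.
Qed.

Lemma max_extension_ge V X : V_set V -> LB X ->
  \forall t \ae P, V X t - s V t <= y X t.
Proof.
move=> VV lX; have [_ ub _] := xhat_is_esssup lX.
have /ub : S X (fun t => (V X t)%:E - x_conj V t)%E by exists V.
apply: filterS3 (conj_finE VV) (max_extensionE lX) => t -> ->.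
by rewrite -EFinB lee_fin.
Qed.

Lemma max_extension_mf X : LB X -> mf A (y X).
Proof.
move=> lX; have mx : mf A (xhat P A p L x m M X).
  by apply: (mf_esssup cA (S0 X)) => h; exact: mS.
exact: (@measurableT_comp _ _ _ (g_sigma_algebraType A) _ _ fine).
Qed.

(** Leastness of the supremum, localized: outside [H] the candidate bound [g] is replaced by [y X],
    which is always a bound. *)
Lemma max_extension_local (X g : T -> R) H : LB X -> A H -> mf A g ->
  (forall V, V_set V -> \forall t \ae P, H t -> V X t - s V t <= g t) ->
  \forall t \ae P, H t -> y X t <= g t.
Proof.
move=> lX AH mg Vg; have [_ _ least] := xhat_is_esssup lX.
pose h := (\1_H \* g) \+ (\1_(~` H) \* y X).
have AM K (f : T -> R) : A K -> mf A f -> mf A (\1_K \* f).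
  move=> AK mf_; apply: (@measurable_funM _ (g_sigma_algebraType A)) => //.
  by have := subalgebra_indic cA AK; exact.
have mh : measurable_fun [set: T] h.
  have mA : mf A h.
    apply: (@measurable_funD _ (g_sigma_algebraType A)); first exact: AM.
    by apply: AM; [exact: (subalgebraC cA AH)|exact: max_extension_mf].
  by have := subalgebra_measurable_fun cA mA; exact.
have hE t : h t = if t \in H then g t else y X t.
  rewrite /h /= !indicE in_setC.
  by case: (_ \in _); rewrite /= ?mul1r ?mul0r ?addr0 ?add0r.
have {least} : \forall t \ae P, (xhat P A p L x m M X t <= (h t)%:E)%E.
  apply: least; first exact/measurable_EFinP.
  move=> _ [V VV <-].
  apply: filterS3 (Vg _ VV) (max_extension_ge VV lX) (conj_finE VV) => t Vgt Vy ->.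
  rewrite -EFinB lee_fin hE; case: ifPn => // tH; apply: Vgt.
  exact: set_mem.
apply: filterS2 (max_extensionE lX) => t -> + Ht.
by rewrite lee_fin hE mem_set.
Qed.

Lemma max_extension_least (X g : T -> R) : LB X -> mf A g ->
  (forall V, V_set V -> \forall t \ae P, V X t - s V t <= g t) ->
  ae_le P (y X) g.
Proof.
move=> lX mg Vg.
have := max_extension_local lX (subalgebraT cA) mg.
have H V : V_set V -> \forall t \ae P, [set: T] t -> V X t - s V t <= g t.
  by move=> /Vg; apply: filterS => t + _.
by move=> /(_ H); apply: filterS => t; exact.
Qed.

Lemma max_extension_LA X : LB X -> LA (y X).
Proof.
move=> lX; have lXp := Lp_funrpos p1 cB lX; have lXn := Lp_funrneg p1 cB lX.
have lM := LpD p1 (M_op.1 _ lXp).1 (M_op.1 _ lXn).1.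
apply: (Lp_dominated p1 cA lM); first exact: max_extension_mf.
have [V VV V0] := VS_conjugate0.
have up : ae_le P (y X) (M X^\+).
  apply: max_extension_least => //; first exact: Lp_mf (M_op.1 _ lXp).1.
  move=> W WW; apply: filterS2 (VS_le WW lX) (conj_fin_ge0 WW) => t ? ?; lra.
have lo : \forall t \ae P, - M X^\- t <= y X t.
  apply: filterS3 V0 (VS_ge VV lX) (max_extension_ge VV lX) => t -> ? ?; lra.
have Mp : ae_le P (cst 0) (M X^\+) := (M_op.1 _ lXp).2.
have Mn : ae_le P (cst 0) (M X^\-) := (M_op.1 _ lXn).2.
have Mpn : \forall t \ae P, 0 <= M X^\+ t /\ 0 <= M X^\- t.
  by apply: filterS2 Mp Mn => t ? ?; split.
apply: filterS3 up lo Mpn => t up lo [M1 M2]; rewrite /= [leRHS]ger0_norm ?addr_ge0//.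
by rewrite ler_norml; apply/andP; split; lra.
Qed.

Lemma max_extension_monotone : monotone_on P LB y.
Proof.
move=> X Y lX lY XY; apply: max_extension_least => //; first exact: max_extension_mf.
move=> V VV; have [_ [[V_lin _ V_nneg _] _]] := VV.
have := positive_operator_le p1 V_lin V_nneg lX lY XY.
by apply: filterS2 (max_extension_ge VV lY) => t ? ?; lra.
Qed.

Lemma max_extension_operator : is_operator P LB LA y.
Proof.
split=> [X lX|X Y lX lY XY]; first exact: max_extension_LA.
have XY1 : ae_le P X Y by apply: filterS XY => t /(_ I) ->.
have XY2 : ae_le P Y X by apply: filterS XY => t /(_ I) ->.
apply: filterS2 (max_extension_monotone lX lY XY1)
  (max_extension_monotone lY lX XY2) => t ? ? _.
by apply/eqP; rewrite eq_le; apply/andP.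
Qed.

Lemma max_extension_extends X : L X -> y X = x X %[ae P].
Proof.
move=> lX; have lXB := L_sub lX.
have up : ae_le P (y X) (x X).
  apply: max_extension_least => //; first by apply: Lp_mf; exact: x_op.1.
  by move=> V VV; apply: filterS (conj_fin_ge VV lX) => t ?; lra.
have [V VV VE] := VS_supporting_operator L_sub L_add L_scale L_one L_indic x_op
  x_conv x_hom x_sand lX.
have lo : ae_le P (x X) (y X).
  apply: filterS3 VE (conj_finE VV) (max_extension_ge VV lXB) => t ->.
  by move=> [<-]; lra.
by apply: filterS2 up lo => t ? ? _; apply/eqP; rewrite eq_le; apply/andP.
Qed.

Lemma max_extension_convex : convex_on P LB y.
Proof.
move=> X Y l lX lY l01.
have [l0 l1] : 0 <= l /\ 0 <= 1 - l by lra.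
have lXY : LB (l \*: X \+ (1 - l) \*: Y) by apply: LpL => //; exact: LpZ.
apply: max_extension_least => //.
  apply: (@measurable_funD _ (g_sigma_algebraType A)).
    by apply: measurable_funM => //; exact: max_extension_mf.
  by apply: measurable_funM => //; exact: max_extension_mf.
move=> V VV; have [_ [[V_lin _ _ _] _]] := VV.
have EV : \forall t \ae P, V (l \*: X \+ (1 - l) \*: Y) t = l * V X t + (1 - l) * V Y t.
  have := linear_operatorZ cB p1 V_lin (1 - l) lY.
  apply: filterS2 (linear_operatorE V_lin l lX (LpZ p1 (1 - l) cB lY)) => t -> ->.
  by [].
apply: filterS3 EV (max_extension_ge VV lX) (max_extension_ge VV lY) => t -> yX yY.
have := ler_wpM2l l0 yX; have := ler_wpM2l l1 yY.
rewrite /= -[l *: _]/(l * _) -[(1 - l) *: _]/((1 - l) * _); lra.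
Qed.

(** On [H] the members for [\1_H \* X] and for [X] coincide. Off [H] the members reduce to minus the
    conjugates, whose supremum is 0. *)
Lemma max_extension_homogeneous : weak_homogeneous_on P A LB y.
Proof.
move=> H X AH lX; have mH : d.-measurable H by case: cA => _ + _; exact.
have AHC := subalgebraC cA AH.
have lHX := Lp_indicM p1 cB mH lX.
have VH V : V_set V -> \forall t \ae P, V (\1_H \* X) t = \1_H t * V X t.
  move=> [_ [[_ _ _ V_hom] _]].
  have lH : LA (\1_H : T -> R).
    have := Lp_indicM p1 cA AH (Lp_cst p1 1 cA); congr (Lp P A p).
    by apply/funext => t /=; rewrite mulr1.
  by apply: filterS (V_hom _ _ lX lH lHX) => t /(_ I).
have up : \forall t \ae P, H t -> y (\1_H \* X) t <= y X t.
  apply: max_extension_local => //; first exact: max_extension_mf.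
  move=> V VV; apply: filterS2 (VH _ VV) (max_extension_ge VV lX) => t -> + Ht.
  by rewrite indicE mem_set// mul1r.
have lo : \forall t \ae P, H t -> y X t <= y (\1_H \* X) t.
  apply: max_extension_local => //; first exact: max_extension_mf.
  move=> V VV; apply: filterS2 (VH _ VV) (max_extension_ge VV lHX) => t -> + Ht.
  by rewrite indicE mem_set// mul1r.
have upC : \forall t \ae P, (~` H) t -> y (\1_H \* X) t <= 0.
  apply: (max_extension_local (g := cst 0)) => //.
  move=> V VV; apply: filterS2 (VH _ VV) (conj_fin_ge0 VV) => t -> s0 Ht.
  by rewrite indicE memNset// mul0r /=; lra.
have [V VV V0] := VS_conjugate0.
have loC : \forall t \ae P, (~` H) t -> 0 <= y (\1_H \* X) t.
  apply: filterS3 V0 (VH _ VV) (max_extension_ge VV lHX) => t -> -> + Ht.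
  by rewrite indicE memNset// mul0r; lra.
have onH : \forall t \ae P, H t -> y (\1_H \* X) t = y X t.
  by apply: filterS2 up lo => t u l Ht; apply/eqP; rewrite eq_le u ?l.
apply: filterS3 onH upC loC => t onH u l _ /=; rewrite indicE.
have [tH|tH] := boolP (t \in H).
  by rewrite mul1r onH//; exact: set_mem.
have Ht : (~` H) t by move=> Ht; move/negP: tH; apply; exact: mem_set.
by rewrite mul0r; apply/eqP; rewrite eq_le u ?l.
Qed.

Lemma max_extension_projection : projection_on P A p LB y.
Proof.
move=> X lXA lX; have [V VV V0] := VS_conjugate0.
have up : ae_le P (y X) X.
  apply: max_extension_least => //; first exact: Lp_mf lXA.
  move=> W WW; apply: filterS2 (VS_projection WW lXA) (conj_fin_ge0 WW) => t -> ?.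
  lra.
have lo : ae_le P X (y X).
  apply: filterS3 V0 (VS_projection VV lXA) (max_extension_ge VV lX) => t -> ->.
  lra.
by apply: filterS2 up lo => t ? ? _; apply/eqP; rewrite eq_le; apply/andP.
Qed.

Lemma max_extension_sandwich : sandwich P p m M LB y.
Proof.
move=> X Y Z lX lY lZ ZXY.
have : ae_le P (y X) (M Y \- m Z).
  apply: max_extension_least => //.
    apply: (@measurable_funB _ (g_sigma_algebraType A)).
      exact: Lp_mf (M_op.1 _ lY).1.
    exact: Lp_mf (m_op.1 _ lZ).1.
  move=> V VV; have [_ [[V_lin _ V_nneg _] [_ V_bnd]]] := VV.
  have lZX : LB (Z \+ X) by apply: LpD => //; exact: lZ.1.
  have VYZ : \forall t \ae P, V Z t + V X t <= V Y t.
    have := positive_operator_le p1 V_lin V_nneg lZX lY.1 ZXY.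
    by apply: filterS2 (linear_operatorD V_lin lZ.1 lX) => t ->.
  have VmM : \forall t \ae P, m Z t <= V Z t /\ V Y t <= M Y t.
    by apply: filterS2 (V_bnd _ lZ).1 (V_bnd _ lY).2 => t ? ?; split.
  apply: filterS3 VYZ VmM (conj_fin_ge0 VV) => t ? [? ?] ? /=; lra.
by apply: filterS => t /=; lra.
Qed.

(* [y] is a supremum of the continuous maps [V - x^*(V)], so a point of the
   closure of [y <= eta] violating [V X - x^*(V) <= eta] on a set [H] of positive
   measure is separated from it by testing against the indicator of [H]. *)
Lemma max_extension_lsc : Defs.lower_semicontinuous P A p y.
Proof.
move=> eta leta X lX Xcl; split => //.
apply: max_extension_least => //; first exact: Lp_mf leta.
move=> V VV; have [V_op [[_ V_cont _ _] _]] := VV.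
have lVX := V_op.1 _ lX.
(* The slack of the inequality to be proved; [H] is the set where it is negative. *)
pose D t := eta t + s V t - V X t.
have mD : mf A D.
  apply: (@measurable_funB _ (g_sigma_algebraType A)); last exact: Lp_mf lVX.
  apply: (@measurable_funD _ (g_sigma_algebraType A)); first exact: Lp_mf leta.
  exact: conj_fin_mf VV.
have iD : L1 P D.
  apply: L1B; last exact: (Lp_L1 p1 lVX).
  by apply: L1D; [exact: (Lp_L1 p1 leta)|exact: conj_fin_L1].
suff : ae_le P (cst 0) D by apply: filterS => t; rewrite /D /=; lra.
have m0 : mf A (cst 0 : T -> R) by exact: measurable_cst.
have AH := subalgebra_lt cA mD m0; set H := [set t | _] in AH.
have mH : d.-measurable H by case: cA => _ + _; exact.
have iHD : L1 P (\1_H \* D) by exact: L1_indic.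
have HD0 : ae_le P (\1_H \* D) (cst 0).
  apply: aeW => t /=; rewrite indicE; have [|_] := boolP (t \in H).
    by rewrite inE /H/= mul1r => /ltW.
  by rewrite mul0r.
have iNHD : L1 P ((-1) \*: (\1_H \* D)) by exact: L1Z.
have [e0|e0] := ltP 0 (Ev P ((-1) \*: (\1_H \* D))); last first.
  have : \forall t \ae P, ((-1) \*: (\1_H \* D)) t = 0.
    apply: Ev_eq0 => //; apply: filterS HD0 => t /=.
    by rewrite -[_ *: _]/(_ * _); lra.
  apply: filterS => t /=; rewrite -[_ *: _]/(_ * _) indicE.
  have [|/negP] := boolP (t \in H); rewrite inE /H/=.
    by rewrite mul1r; lra.
  by move=> /negP; rewrite -leNgt.
(* [e] is the expectation of the negative part of [D]. A [Y] with [y Y <= eta] satisfies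
   [V Y - V X <= D], so [V Y] differs from [V X] by at least [e] when tested on [H]. *)
set e := Ev P _ in e0; exfalso.
pose U := [set W : T -> R | LA W -> `|Ev P (\1_H \* (W \- V X))| < e].
have XU : Lp_nbhs P A p (V X) U.
  have [poo|pN] := eqVneq p +oo%E.
    rewrite /Lp_nbhs poo eqxx.
    exists 1%N, (fun=> \1_H), e; split => // [_|W lW We].
      have := Lp_indicM (lexx 1%E) cA AH (Lp_cst (lexx 1%E) 1 cA).
      by congr (Lp P A 1%E); apply/funext => t /=; rewrite mulr1.
    move=> lW'; have := We ord0; rewrite expectation_Ev ?lte_fin//.
    by apply: L1_indic => //; apply: L1B; [exact: (Lp_L1 p1 lW')|exact: (Lp_L1 p1 lVX)].
  (* For finite [p], testing against an indicator is bounded by the L_1 norm, hence by the L_p norm,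
     so the same radius works. *)
  rewrite /Lp_nbhs (negPf pN); exists e => // W lW We lW'.
  have lWV := LpB p1 lW lVX.
  have iWV : L1 P (W \- V X) by exact: (Lp_L1 p1 lWV).
  have iHWV : L1 P (\1_H \* (W \- V X)) by exact: L1_indic.
  rewrite -lte_fin; apply: le_lt_trans We.
  apply: (@le_trans _ _ ('N[P]_1[EFin \o (W \- V X)%R])%E); last first.
    exact: (Lnorm1_le P p1 pN (L1_measurable iWV)).
  rewrite Lnorm1 EFin_normr_Rintegral//.
  apply: (le_trans (le_abse_integral _ _ (measurable_int _ iHWV))) => //.
  apply: ge0_le_integral => //.
  - by apply: measurableT_comp => //; exact: measurable_int iHWV.
  - by apply: measurableT_comp => //; exact: measurable_int iWV.
  move=> t _; rewrite lee_fin normrM indicE.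
  by case: (_ \in _); rewrite ?normr1 ?normr0 ?mul1r ?mul0r.
have [Y lY [[_ yY] UY]] := Xcl _ (V_cont _ lX _ XU).
have lVY := V_op.1 _ lY; have /UY : LA (V Y) by [].
apply/negP; rewrite -leNgt -normrN; apply: le_trans (ler_norm _).
rewrite /e EvZ// mulN1r lerN2; apply: le_Ev => //.
  by apply: L1_indic => //; apply: (L1B (Lp_L1 p1 lVY) (Lp_L1 p1 lVX)).
apply: filterS2 yY (max_extension_ge VV lY) => t yY VY /=.
by apply: ler_wpM2l => //; rewrite /D; lra.
Qed.

Lemma max_extension_sandwich_extension : sandwich_extension P A p L x m M y.
Proof.
split.
- exact: max_extension_operator.
- exact: max_extension_extends.
- exact: max_extension_convex.
- exact: max_extension_monotone.
- exact: max_extension_lsc.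
- exact: max_extension_homogeneous.
- exact: max_extension_projection.
- exact: max_extension_sandwich.
Qed.

(* The operator supporting [z] at [X0] belongs to [VS] for [x], because
   extending the domain only increases the conjugate. *)
Lemma max_extension_max z : sandwich_extension P A p L x m M z ->
  forall X0, LB X0 -> ae_le P (z X0) (y X0).
Proof.
move=> [z_op z_ext z_conv _ _ z_hom _ z_sand] X0 lX0.
have iz X : LB X -> L1 P (z X) by move=> lX; apply: (Lp_L1 p1); exact: z_op.1.
have LB1 : LB (cst 1) by exact: Lp_cst.
have LBI H X : A H -> LB X -> LB (\1_H \* X).
  by move=> AH; apply: Lp_indicM => //; case: cA => _ + _; exact.
have [V VV VE] := VS_supporting_operator (@subset_refl _ LB)
  (fun X Y => @LpD _ _ _ P p p1 _ X Y) (fun a X => @LpZ _ _ _ P p p1 _ a X cB)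
  LB1 LBI z_op z_conv z_hom z_sand lX0.
have [V_op [[V_lin V_cont V_nneg V_hom] [_ V_bnd]]] := VV.
have iV X : LB X -> L1 P (V X) by move=> lX; apply: (Lp_L1 p1); exact: V_op.1.
have VzX X : L X -> \forall t \ae P, V X t - x X t <= V X0 t - z X0 t.
  move=> lX; have := conjugate_ge cA (@subset_refl _ LB) LB1 z_op V_op (L_sub lX).
  apply: filterS3 (z_ext _ lX) VE => t /(_ I) -> ->.
  by rewrite lee_fin.
have V_setV : V_set V.
  split => //; split => //; split => //.
  apply: (@le_lt_trans _ _ (Ev P (V X0 \- z X0))%:E); last exact: ltry.
  apply: (integral_conjugate_le cA cB p1 L_sub L_add L_one L_indic x_op x_hom V_op
    V_lin V_hom) => X lX.
  apply: le_Ev; last exact: VzX.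
    by apply: L1B; [exact: iV (L_sub lX)|apply: (Lp_L1 p1); exact: x_op.1].
  by apply: L1B; [exact: iV|exact: iz].
have sle : \forall t \ae P, s V t <= V X0 t - z X0 t.
  have [_ _ least] := conjugate_is_esssup cA L_sub L_one x_op V_op.
  have : \forall t \ae P, (x_conj V t <= (V X0 t - z X0 t)%:E)%E.
    apply: least.
      apply/measurable_EFinP; apply: L1_measurable.
      by apply: L1B; [exact: iV|exact: iz].
    by move=> _ [X lX <-]; apply: filterS (VzX _ lX) => t; rewrite lee_fin.
  by apply: filterS2 (conj_finE V_setV) => t ->; rewrite lee_fin.
by apply: filterS2 sle (max_extension_ge V_setV lX0) => t ? ?; lra.
Qed.

End MaximalExtension.

Theorem theorem3p1 (d : measure_display) (T : measurableType d) (R : realType)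
    (P : probability T R)
    (P_complete : measure_is_complete P)
    (B_generated : completion_of_countably_generated P d.-measurable)
    (A : set (set T))
    (A_generated : augmented_countably_generated P A)
    (p : \bar R) (p_ge1 : (1 <= p)%E)
    (L : set (T -> R)) (L_good : good_subspace P A p L)
    (x : (T -> R) -> T -> R) (x_star : type_star P A p L x)
    (m M : (T -> R) -> T -> R)
    (m_operator :
      is_operator P (Lp_nneg P d.-measurable p) (Lp_nneg P A p) m)
    (M_operator :
      is_operator P (Lp_nneg P d.-measurable p) (Lp_nneg P A p) M)
    (m_homogeneous : weak_homogeneous_on P A (Lp_nneg P d.-measurable p) m)
    (M_homogeneous : weak_homogeneous_on P A (Lp_nneg P d.-measurable p) M)
    (m_superlinear : superlinear P p m)
    (M_sublinear : sublinear P p M)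
    (M_regular : p = +oo%E -> regular P p M)
    (x_sandwich : sandwich P p m M L x) :
  exists y : (T -> R) -> T -> R,
    [/\ sandwich_extension P A p L x m M y,
        forall X, Lp P d.-measurable p X ->
          EFin \o y X = xhat P A p L x m M X %[ae P]
      & forall z : (T -> R) -> T -> R, sandwich_extension P A p L x m M z ->
          forall X, Lp P d.-measurable p X -> ae_le P (z X) (y X)].
Proof.
have cB := measurable_complete_subalgebra P_complete.
have cA := augmented_complete_subalgebra P_complete A_generated.
have [L_sub _ L_add L_scale L_one L_indic _] := L_good.
have [x_op [_ x_conv _ x_hom x_proj]] := x_star.
exists (max_extension P A p m M L x); split.
- exact: max_extension_sandwich_extension.
- move=> X lX.
  have := max_extensionE cA cB p_ge1 m_operator M_operator m_homogeneous
    M_homogeneous m_superlinear M_sublinear M_regular L_sub L_add L_scale L_one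
    L_indic x_op x_conv x_hom x_sandwich lX.
  by apply: filterS => t -> _.
- exact: max_extension_max.
Qed.
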